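(* Let $\mathcal{C}$ be a category of partitions, let $N$ be an integer and let $\mathbb{G}$ be the associated easy quantum group. Then the irreducible representations of $\mathbb{G}$ can be labelled as $u_p(\alpha)$, where $p$ is a projective partition in $\mathcal{C}$ and $\alpha$ is an irreducible representation of $\mathrm{Sym}_{\mathcal{C}}(p)$ (i.e. every irreducible representation of $\mathbb{G}$ is equivalent to some $u_p(\alpha)$). Furthermore, for every $k$ there are integers $0\leq\nu_p(\alpha)\leq\dim(\alpha)$, for every pair $(p,\alpha)$ with $p\in\mathrm{Proj}_{\mathcal{C}}(k)$ and $\alpha\in\mathrm{Irr}(\mathrm{Sym}_{\mathcal{C}}(p))$, such that $$u^{\otimes k}=\bigoplus_{p\in\mathrm{Proj}_{\mathcal{C}}(k)}\ \bigoplus_{\alpha\in\mathrm{Irr}(\mathrm{Sym}_{\mathcal{C}}(p))}\nu_p(\alpha)\,u_p(\alpha)$$ (up to unitary equivalence).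
   Context: Partitions. For integers $k,l\ge 0$, $P(k,l)$ is the set of set-partitions (into blocks) of the disjoint union of $k$ upper points, labelled $1,\dots,k$ from left to right, and $l$ lower points, labelled $1',\dots,l'$. A through-block is a block containing both upper and lower points; $b(p)$ and $t(p)$ are the numbers of blocks and of through-blocks, and $\beta(p)=b(p)-t(p)$. Operations: $p\otimes q$ is horizontal concatenation; for $p\in P(k,l)$, $q\in P(l,m)$, the composition $qp\in P(k,m)$ is vertical concatenation ($p$ on top, $q$ below, the lower points of $p$ identified with the upper points of $q$, then the middle points removed); $p^{*}\in P(l,k)$ is $p$ turned upside down; a rotation moves the leftmost (or rightmost) point of one row to the leftmost (resp. rightmost) position of the other row, keeping the block structure. The identity partition $|\in P(1,1)$ has a single block. A partition $p\in P(k,k)$ is projective if $p=p^{*}=pp$. A category of partitions $\mathcal{C}$ is a collection of subsets $\mathcal{C}(k,l)\subseteq P(k,l)$ ($k,l\ge0$) closed under tensor product, composition (when defined), involution and rotation, with $|\in\mathcal{C}(1,1)$. $\mathrm{Proj}_{\mathcal{C}}(k)$ is the set of projective partitions in $\mathcal{C}(k,k)$. For projective $p,q\in P(k,k)$, $q\preceq p$ means $pq=q$ (equivalently $qp=q$), and $q\prec p$ means $q\preceq p$, $q\ne p$. Linear maps. Let $N\geq 1$ and let $e_1,\dots,e_N$ be the canonical basis of $\mathbb{C}^N$. For $p\in P(k,l)$, $\mathring{T}_p:(\mathbb{C}^N)^{\otimes k}\to(\mathbb{C}^N)^{\otimes l}$ is $\mathring{T}_p(e_{i_1}\otimes\cdots\otimes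 e_{i_k})=\sum_{j_1,\dots,j_l=1}^N\delta_p(i,j)\,e_{j_1}\otimes\cdots\otimes e_{j_l}$, where $\delta_p(i,j)=1$ if, after labelling the upper points by $i$ and the lower points by $j$, all points in a common block have equal labels, and $\delta_p(i,j)=0$ otherwise. Set $T_p=N^{-\beta(p)/2}\mathring{T}_p$ (for projective $p$, $T_p$ is an orthogonal projection). Easy quantum groups. The easy quantum group associated with $\mathcal{C}$ and $N$ is the unique compact matrix quantum group $\mathbb{G}$ ($S_N\subset\mathbb{G}\subset O_N^+$) with $N$-dimensional fundamental representation $u$ such that $\mathrm{Hom}(u^{\otimes k},u^{\otimes l})=\mathrm{Span}\{T_p: p\in\mathcal{C}(k,l)\}$ for all $k,l\ge0$. Representations $u_p$. For $p\in\mathrm{Proj}_{\mathcal{C}}(k)$ let $R_p=\bigvee_{q\in\mathrm{Proj}_{\mathcal{C}}(k),\,q\prec p}T_q$ (supremum among projections of the finite-dimensional von Neumann algebra $\mathrm{Hom}(u^{\otimes k},u^{\otimes k})$, $0$ if there is no such $q$), $P_p=T_p-R_p$, and $u_p=(\iota\otimes P_p)(u^{\otimes k})$, the subrepresentation of $u^{\otimes k}$ on the range of $P_p$, where $\iota$ is the identity of $C(\mathbb{G})$ ($u_p$ may be zero). Put $\mathrm{Aut}(u_p)=\mathrm{Hom}(u_p,u_p)=P_p\,\mathrm{Hom}(u^{\otimes k},u^{\otimes k})\,P_p$. Symmetry group. A building partition is $s\in P(k,l)$ such that its lower points lie in pairwise different blocks, each lower point $x'$ is connected to at least one upper point (let $\min_{\mathrm{up}}(x')$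 be the smallest such upper point), and $\min_{\mathrm{up}}(a')<\min_{\mathrm{up}}(b')$ whenever $a'<b'$. Every projective $p\in P(k,k)$ can be written uniquely as $p=p_u^{*}p_u$ with $p_u\in P(k,t(p))$ a building partition. For $\sigma\in S_n$ let $r_\sigma\in P(n,n)$ be the pair partition whose blocks are $\{i,\sigma(i)'\}$, $1\le i\le n$. For $p\in\mathrm{Proj}_{\mathcal{C}}(k)$ and $\sigma\in S_{t(p)}$ put $p_\sigma=p_u^{*}r_\sigma p_u$ and $\mathrm{Sym}_{\mathcal{C}}(p)=\{\sigma\in S_{t(p)}: p_\sigma\in\mathcal{C}(k,k)\}$, a subgroup of $S_{t(p)}$ (the trivial group if $t(p)=0$). Representations $u_p(\alpha)$. The map $\Psi:\mathbb{C}[\mathrm{Sym}_{\mathcal{C}}(p)]\to\mathrm{Aut}(u_p)$, $\delta_\sigma\mapsto P_pT_{p_\sigma}P_p$, is a surjective $*$-homomorphism, and $\mathbb{C}[\mathrm{Sym}_{\mathcal{C}}(p)]\cong\bigoplus_{\alpha}M_{\dim(\alpha)}(\mathbb{C})$ over $\alpha\in\mathrm{Irr}(\mathrm{Sym}_{\mathcal{C}}(p))$. For such $\alpha$, $u_p(\alpha)$ denotes the subrepresentation of $u_p$ on the range of $\Psi(e)$, where $e$ is a minimal projection of the summand $M_{\dim(\alpha)}(\mathbb{C})$ indexed by $\alpha$. Up to equivalence it does not depend on $e$, and it is either zero or irreducible; when it is zero the pair $(p,\alpha)$ labels no irreducible representation. *)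

(* Defs.v *)
From HB Require Import structures.
From mathcomp Require Import all_boot all_order all_algebra all_fingroup.
From mathcomp Require Import mxrepresentation sesquilinear spectral.
From mathcomp Require classical_sets.

Set Implicit Arguments.
Unset Strict Implicit.
Unset Printing Implicit Defensive.

Import GRing.Theory Num.Theory.
Local Open Scope ring_scope.
Local Open Scope sesquilinear_scope.

Record setpart (T : finType) := SetPart {
  blocks :> {set {set T}};
  blocksP : partition blocks [set: T] }.

Section SetPartFinite.
Variable T : finType.
HB.instance Definition _ := [isSub for @blocks T].
HB.instance Definition _ := [Finite of setpart T by <:].
End SetPartFinite.

Definition same_block (T : finType) (p : setpart T) : rel T :=
  [rel x y | y \in pblock p x].

(* The partition of T into the nonempty fibres of f. *)
Definition fibre_part (T : finType) (rT : eqType) (f : T -> rT) : setpart T :=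
  SetPart (preim_partitionP f [set: T]).

(* [inl i] is the upper point i+1, [inr j] the lower point (j+1)'. *)
Notation points k l := ('I_k + 'I_l)%type.
Notation part k l := (setpart ('I_k + 'I_l)%type).

Definition ptensor_fun k l k' l' (p : part k l) (q : part k' l')
    (x : points (k + k') (l + l')) : {set points k l} + {set points k' l'} :=
  match x with
  | inl i => match split i with
             | inl a => inl (pblock p (inl a))
             | inr b => inr (pblock q (inl b)) end
  | inr j => match split j with
             | inl a => inl (pblock p (inr a))
             | inr b => inr (pblock q (inr b)) end
  end.

Definition ptensor k l k' l' (p : part k l) (q : part k' l') :
  part (k + k') (l + l') := fibre_part (ptensor_fun p q).

(* The stacked diagram of p (on top) and q has three rows of points. *)
Definition in_top k l m (x : 'I_k + 'I_l + 'I_m) : option (points k l) :=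
  match x with inl a => Some a | inr _ => None end.

Definition in_bottom k l m (x : 'I_k + 'I_l + 'I_m) : option (points l m) :=
  match x with
  | inl (inl _) => None
  | inl (inr j) => Some (inl j)
  | inr h => Some (inr h)
  end.

Definition osame_block (T : finType) (p : setpart T) (x y : option T) : bool :=
  match x, y with Some a, Some b => same_block p a b | _, _ => false end.

(* This relation is symmetric, so that [root] picks one representative in each
   connected component. *)
Definition stacked k l m (p : part k l) (q : part l m) :
    rel ('I_k + 'I_l + 'I_m) :=
  [rel x y | osame_block p (in_top x) (in_top y)
          || osame_block q (in_bottom x) (in_bottom y)].

Definition outer k l m (x : points k m) : 'I_k + 'I_l + 'I_m :=
  match x with inl i => inl (inl i) | inr h => inr h end.

(* [pcomp q p] is the composition qp: p on top, q below. *)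
Definition pcomp k l m (q : part l m) (p : part k l) : part k m :=
  fibre_part (fun x : points k m => fingraph.root (stacked p q) (outer l x)).

Definition swap_row k l (x : points k l) : points l k :=
  match x with inl i => inr i | inr j => inl j end.

Definition pinv k l (p : part k l) : part l k :=
  fibre_part (fun x : points l k => pblock p (swap_row x)).

(* The upper point a becomes the lower point at position b, the order of the
   other points being kept. *)
Definition move_down_fun k l (a : 'I_k.+1) (b : 'I_l.+1)
    (x : points k l.+1) : points k.+1 l :=
  match x with
  | inl i => inl (lift a i)
  | inr j => match unlift b j with Some j' => inr j' | None => inl a end
  end.

Definition move_down k l (a : 'I_k.+1) (b : 'I_l.+1) (p : part k.+1 l) :
  part k l.+1 := fibre_part (fun x => pblock p (move_down_fun a b x)).

Definition move_up_fun k l (a : 'I_k.+1) (b : 'I_l.+1)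
    (x : points k.+1 l) : points k l.+1 :=
  match x with
  | inl i => match unlift a i with Some i' => inl i' | None => inr b end
  | inr j => inr (lift b j)
  end.

Definition move_up k l (a : 'I_k.+1) (b : 'I_l.+1) (p : part k l.+1) :
  part k.+1 l := fibre_part (fun x => pblock p (move_up_fun a b x)).

Definition rperm n (s : 'S_n) : part n n :=
  fibre_part (fun x : points n n => match x with inl i => s i | inr j => j end).

Definition pid : part 1 1 := rperm 1%g.

Definition nblocks k l (p : part k l) : nat := #|blocks p|.

Definition through k l (B : {set points k l}) : bool :=
  [exists i, inl i \in B] && [exists j, inr j \in B].

Definition nthrough k l (p : part k l) : nat :=
  #|[set B in blocks p | through B]|.

Definition nbeta k l (p : part k l) : nat := (nblocks p - nthrough p)%N.

Definition projective k (p : part k k) : bool :=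
  (p == pinv p) && (p == pcomp p p).

Definition preceq k (q p : part k k) : bool := pcomp p q == q.
Definition prec k (q p : part k k) : bool := preceq q p && (q != p).

(* Equal to k when no upper point is connected to j', which does not occur for
   building partitions. *)
Definition min_up k l (s : part k l) (j : 'I_l) : nat :=
  \big[minn/k]_(i < k | same_block s (inr j) (inl i)) i.

Definition building k l (s : part k l) : bool :=
  [&& [forall a : 'I_l, forall b : 'I_l,
        (a != b) ==> ~~ same_block s (inr a) (inr b)],
      [forall j : 'I_l, exists i : 'I_k, same_block s (inr j) (inl i)]
    & [forall a : 'I_l, forall b : 'I_l,
        (a < b)%N ==> (min_up s a < min_up s b)%N]].

(* The upper part p_u; the default value is irrelevant for projective p. *)
Definition upart k (p : part k k) : part k (nthrough p) :=
  odflt (fibre_part id)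
    [pick s : part k (nthrough p) | building s && (p == pcomp (pinv s) s)].

Definition psigma k (p : part k k) (s : 'S_(nthrough p)) : part k k :=
  pcomp (pinv (upart p)) (pcomp (rperm s) (upart p)).
Arguments psigma {k} p s.

Record category := Category {
  cat_mem :> forall k l, {set part k l};
  cat_tensor : forall k l k' l' (p : part k l) (q : part k' l'),
    p \in cat_mem k l -> q \in cat_mem k' l' ->
    ptensor p q \in cat_mem (k + k')%N (l + l')%N;
  cat_comp : forall k l m (p : part k l) (q : part l m),
    p \in cat_mem k l -> q \in cat_mem l m -> pcomp q p \in cat_mem k m;
  cat_inv : forall k l (p : part k l),
    p \in cat_mem k l -> pinv p \in cat_mem l k;
  cat_down_left : forall k l (p : part k.+1 l),
    p \in cat_mem k.+1 l -> move_down ord0 ord0 p \in cat_mem k l.+1;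
  cat_down_right : forall k l (p : part k.+1 l),
    p \in cat_mem k.+1 l -> move_down ord_max ord_max p \in cat_mem k l.+1;
  cat_up_left : forall k l (p : part k l.+1),
    p \in cat_mem k l.+1 -> move_up ord0 ord0 p \in cat_mem k.+1 l;
  cat_up_right : forall k l (p : part k l.+1),
    p \in cat_mem k l.+1 -> move_up ord_max ord_max p \in cat_mem k.+1 l;
  cat_id : pid \in cat_mem 1 1 }.

Definition Proj (K : category) k : {set part k k} :=
  [set p in K k k | projective p].

Definition Sym_set (K : category) k (p : part k k) : {set 'S_(nthrough p)} :=
  [set s | psigma p s \in K k k].

(* For p in Proj K k the set Sym_set K p is already a subgroup, and taking the
   generated subgroup only serves to have a {group _} for every p.  In
   MathComp, s * t is "first s, then t": composition of permutations in the
   usual sense is the opposite product, whose group algebra has the same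
   projections, the same two-sided ideals and the same dimensions; a
   representation acting on row vectors is turned by transposition into a
   representation, acting on column vectors, of the opposite group. *)
Definition Sym (K : category) k (p : part k k) : {group 'S_(nthrough p)} :=
  <<Sym_set K p>>%G.

(* A multi-index (i_1, ..., i_k); the basis vector e_{i_1} (x) ... (x) e_{i_k}
   of the k-th tensor power has number [enum_rank i]. *)
Notation midx N k := {ffun 'I_k -> 'I_N}.

Section LinearMaps.
Variable F : numClosedFieldType.

Definition is_proj n (P : 'M[F]_n) : Prop := P *m P = P /\ P ^t* = P.

Definition delta_part N k l (p : part k l) (i : midx N k) (j : midx N l) :
    bool :=
  let lab (x : points k l) := match x with inl a => i a | inr b => j b end in
  [forall x, forall y, same_block p x y ==> (lab x == lab y)].

(* Linear maps are matrices acting on column vectors. *)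
Definition Tcirc N k l (p : part k l) : 'M[F]_(#|midx N l|, #|midx N k|) :=
  \matrix_(j, i) (delta_part p (enum_val i) (enum_val j))%:R.

Definition Tmap N k l (p : part k l) : 'M[F]_(#|midx N l|, #|midx N k|) :=
  (sqrtC N%:R) ^- nbeta p *: Tcirc N p.

End LinearMaps.

Record star_algebra (F : numClosedFieldType) := StarAlgebra {
  salg :> algType F;
  star : salg -> salg;
  starK : involutive star;
  starD : {morph star : x y / x + y};
  starZ : forall (a : F) x, star (a *: x) = a^* *: star x;
  starM : forall x y, star (x * y) = star y * star x }.
Arguments star {F s} x.

(* The algebraic tensor product A (x) A, given up to isomorphism by the two
   embeddings x |-> x (x) 1 and y |-> 1 (x) y. *)
Record tensor_square (F : numClosedFieldType) (A : star_algebra F) :=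
  TensorSquare {
  tsq :> star_algebra F;
  tleft : {lrmorphism A -> tsq};
  tright : {lrmorphism A -> tsq};
  tleft_star : forall x, tleft (star x) = star (tleft x);
  tright_star : forall x, tright (star x) = star (tright x);
  tcomm : forall x y, tleft x * tright y = tright y * tleft x;
  tspan : forall z : tsq, exists n (x y : 'I_n -> A),
    z = \sum_i tleft (x i) * tright (y i);
  tindep : forall n (x y : 'I_n -> A),
    (forall c : 'I_n -> F, \sum_i c i *: x i = 0 -> forall i, c i = 0) ->
    \sum_i tleft (x i) * tright (y i) = 0 -> forall i, y i = 0 }.

(* A compact matrix quantum group contained in O_N^+, given by its Hopf
   *-algebra O(G), the *-subalgebra of C(G) generated by the coefficients of
   the fundamental representation u. The coefficients of all finite-dimensional
   representations of G lie in O(G). *)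
Record cmqg (F : numClosedFieldType) (N : nat) := CMQG {
  ring_of :> star_algebra F;
  fund : 'M[ring_of]_N;
  fund_sa : forall i j, star (fund i j) = fund i j;
  fund_orth : fund *m fund^T = 1%:M /\ fund^T *m fund = 1%:M;
  fund_gen : forall S : ring_of -> Prop,
    S 1 -> (forall i j, S (fund i j)) ->
    (forall x y, S x -> S y -> S (x + y)) ->
    (forall x y, S x -> S y -> S (x * y)) ->
    (forall a x, S x -> S (a *: x)) ->
    (forall x, S x -> S (star x)) -> forall x, S x;
  square_of : tensor_square ring_of;
  comult : {lrmorphism ring_of -> square_of};
  comult_star : forall x, comult (star x) = star (comult x);
  comult_fund : forall i j, comult (fund i j) =
    \sum_r tleft square_of (fund i r) * tright square_of (fund r j);
  counit : {lrmorphism ring_of -> F^o};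
  counit_star : forall x, counit (star x) = (counit x)^*;
  counit_fund : forall i j, counit (fund i j) = (i == j)%:R;
  coinv : {linear ring_of -> ring_of};
  coinvM : forall x y, coinv (x * y) = coinv y * coinv x;
  coinv_star : forall x, coinv (star (coinv (star x))) = x;
  coinv_fund : forall i j, coinv (fund i j) = fund j i }.
Arguments fund {F N} c.
Arguments square_of {F N} c.
Arguments comult {F N} c.

Section QuantumGroup.
Variables (F : numClosedFieldType) (N : nat) (G : cmqg F N).

Record mrep := MRep { rdim : nat; rmx :> 'M[G]_rdim }.

Definition mxstar n (v : 'M[G]_n) : 'M[G]_n := \matrix_(i, j) star (v j i).

Definition is_urep (v : mrep) : Prop :=
  [/\ forall i j, comult G (v i j) =
        \sum_r tleft (square_of G) (v i r) * tright (square_of G) (v r j),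
      rmx v *m mxstar v = 1%:M & mxstar v *m rmx v = 1%:M].

Definition scal_mx m n (T : 'M[F]_(m, n)) : 'M[G]_(m, n) :=
  map_mx (in_alg G) T.

Definition Hom (v w : mrep) (T : 'M[F]_(rdim w, rdim v)) : Prop :=
  scal_mx T *m v = w *m scal_mx T.

Definition uequiv (v w : mrep) : Prop :=
  exists T : 'M[F]_(rdim w, rdim v),
    [/\ @Hom v w T, T ^t* *m T = 1%:M & T *m T ^t* = 1%:M].

Definition irreducible (v : mrep) : Prop :=
  (0 < rdim v)%N /\
  forall P : 'M[F]_(rdim v), is_proj P -> @Hom v v P -> P = 0 \/ P = 1%:M.

(* The rows of Q are an orthonormal basis of the row space of P, and Q ^t* is
   an isometry onto the range {P x | x column vector} when P is a projection. *)
Definition subrep (v : mrep) (P : 'M[F]_(rdim v)) : mrep :=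
  let Q := schmidt (row_base P) in
  MRep (scal_mx Q *m v *m scal_mx (Q ^t*)).

Definition rep0 : mrep := MRep (0 : 'M[G]_0).

Definition dsum (v w : mrep) : mrep := MRep (block_mx (rmx v) 0 0 (rmx w)).

Definition dmult (n : nat) (v : mrep) : mrep := iter n (dsum v) rep0.

(* \prod over 'I_k is taken in increasing order of the index. *)
Definition tpow (k : nat) : mrep :=
  MRep (\matrix_(i < #|midx N k|, j < #|midx N k|)
    \prod_(a < k) fund G ((enum_val i : midx N k) a) ((enum_val j : midx N k) a)).

Definition contains_SN : Prop :=
  forall s : 'S_N, exists chi : {lrmorphism G -> F^o},
    (forall x, chi (star x) = (chi x)^*) /\
    (forall i j, chi (fund G i j) = (i == s j)%:R).

Definition easy (K : category) : Prop :=
  contains_SN /\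
  forall k l (S : 'M[F]_(rdim (tpow l), rdim (tpow k))),
    @Hom (tpow k) (tpow l) S <-> exists c : part k l -> F, S = \sum_(p in K k l) c p *: Tmap F N p.

Section UP.
Variables (K : category) (k : nat).

(* Q dominates the family of projections T_q, q < p. *)
Definition dominates (p : part k k) (Q : 'M[F]_(rdim (tpow k))) : Prop :=
  forall q, q \in Proj K k -> prec q p -> Q *m Tmap F N q = Tmap F N q.

Definition is_sup (p : part k k) (R : 'M[F]_(rdim (tpow k))) : Prop :=
  [/\ is_proj R, @Hom (tpow k) (tpow k) R, dominates p R
    & forall Q, is_proj Q -> @Hom (tpow k) (tpow k) Q -> dominates p Q ->
        Q *m R = R].

Definition Rp (p : part k k) : 'M[F]_(rdim (tpow k)) :=
  classical_sets.xget 0 (is_sup p).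

Definition Pp (p : part k k) : 'M[F]_(rdim (tpow k)) := Tmap F N p - Rp p.

(* The group algebra of Sym K p is realised as the span of the (permutation)
   matrices of the regular representation, in which the involution is ^t*; the
   coefficient of s in e is the entry of [gring_row e] at [gring_index s]. *)
Definition gralg (p : part k k) := 'M[F]_(gcard (Sym K p)).

Definition Psi (p : part k k) (e : gralg p) : 'M[F]_(rdim (tpow k)) :=
  \sum_(s in Sym K p) gring_row e 0 (gring_index (Sym K p) s) *:
    (Pp p *m Tmap F N (psigma p s) *m Pp p).

(* Psi e belongs to Pp p *m _ *m Pp p, so that its range lies in the range of
   Pp p: the subrepresentation of u_p = subrep (Pp p) on this range is the
   subrepresentation of the k-th tensor power on it. *)
Definition u_p_alpha (p : part k k) (e : gralg p) : mrep := subrep (Psi e).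

End UP.

End QuantumGroup.

Definition Irr (F : numClosedFieldType) (K : category) k (p : part k k) :
  irrType F (Sym K p) := DecSocleType (regular_repr F (Sym K p)).

Definition minimal_proj (F : numClosedFieldType) (gT : finGroupType)
    (G : {group gT}) (sG : irrType F G) (a : sG) (e : 'M[F]_(gcard G)) : Prop :=
  [/\ is_proj e, (e \in Wedderburn_subring a)%MS, e != 0
    & forall f : 'M[F]_(gcard G), is_proj f ->
        (f \in Wedderburn_subring a)%MS -> e *m f = f -> f = 0 \/ f = e].

(* Main.v *)
Require Import Defs.
From mathcomp Require Import all_boot all_order all_algebra all_fingroup.
From mathcomp Require Import mxrepresentation.
From mathcomp Require Import reals complex.
From mathcomp Require Import pgroup sesquilinear spectral boolp.
From mathcomp Require classical_sets.

(** Everything rests on three facts about the space A of self-intertwiners of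
    the k-th tensor power of u, which is the span of the maps T_p.

    A partition is read through its compatible labellings: p is the relation
    between the upper and the lower multi-indices that together are constant on
    each block.
    Composition of partitions is composition of relations
    ([delta_pcomp]), so that associativity and the behaviour of involution are
    formal. Since labels may be taken in the group Z/N, the number of middle
    labellings in a composition is the size of a coset, which shows that T_q T_p
    is a nonzero multiple of T_qp ([TmapM]).

    The first fact is that P_p A P_p is the image of the group algebra of Sym(p)
    ([corner_Psi]). For r in the category, P_p T_r P_p is a multiple of
    P_p T_r' P_p, where r' is the composition p r p. Let q be the composition of
    r' with its adjoint, a projective partition below p. If q = p then r' is a
    coisometry between the through-blocks of p, hence r' = p_sigma; otherwise q
    is strictly below p and P_p T_q = 0 kills T_r' ([corner_cases]).
    Consequently a minimal projection e of the group algebra is sent to a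
    projection E with E A E reduced to scalar multiples of E.

    The second fact is that the ranges of the P_p together span the tensor
    power ([Pp_total]): along the order of projective partitions, the range of
    T_p is the sum of that of P_p and of those of the T_q with q below p, and the
    identity partition gives the whole space. In the component of the group
    algebra attached to alpha, dim(alpha) products x e y are enough to write the
    unit ([minimal_proj_gen]). So the whole space is the sum of the ranges of
    operators X in A with X = X E, at most dim(alpha) of them for each pair
    (p, alpha).

    The decomposition follows by a Gram-Schmidt process in A: when Q is the
    projection reached so far, (1 - Q) X is a multiple of a partial isometry
    with source E, hence is either zero or adds one copy of u_p(alpha)
    ([greedy_step], [fills_big]).

    The third fact is that an irreducible representation v has a nonzero
    intertwiner D from some tensor power ([irreducible_tpow]). The coefficients
    of v are combinations of words in the entries of u, hence of coefficients of
    a finite sum w of tensor powers. The linear relations between the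
    coefficients of w form a space of matrices stable under enough
    multiplications for its orthogonal complement to be a subcomodule, and v is
    found inside this complement ([mcoef_intertwiner]). Some D X is then nonzero,
    and by the Schur argument it is a multiple of a unitary equivalence from
    u_p(alpha) to v ([Schur_subrep]). *)

Set Implicit Arguments.
Unset Strict Implicit.
Unset Printing Implicit Defensive.

Import Order.TTheory GRing.Theory Num.Theory.
Local Notation pcomp := Defs.pcomp.
Local Notation Sym := Defs.Sym.
Local Notation Hom := Defs.Hom.
Local Open Scope ring_scope.
Local Open Scope sesquilinear_scope.

(** * Partitions and their compatible labellings *)

Lemma same_blockxx (T : finType) (p : setpart T) x : same_block p x x.
Proof.
by rewrite /same_block /= mem_pblock (cover_partition (blocksP p)) inE.
Qed.

Lemma same_blockE (T : finType) (p : setpart T) x y :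
  same_block p x y = (pblock p x == pblock p y).
Proof.
have tI : trivIset p by case/and3P: (blocksP p).
by rewrite eq_pblock //= (cover_partition (blocksP p)) inE.
Qed.

Lemma same_block_sym (T : finType) (p : setpart T) : symmetric (same_block p).
Proof. by move=> x y; rewrite !same_blockE eq_sym. Qed.

Lemma same_block_trans (T : finType) (p : setpart T) : transitive (same_block p).
Proof. by move=> y x z; rewrite !same_blockE => /eqP->. Qed.

Lemma same_block_fibre (T : finType) (rT : eqType) (f : T -> rT) x y :
  same_block (fibre_part f) x y = (f x == f y).
Proof.
rewrite /same_block /= /preim_partition pblock_equivalence_partition ?inE //.
by move=> a b c _ _ _ /=; split=> // /eqP->.
Qed.

Lemma setpart_inj (T : finType) (p q : setpart T) :
  same_block p =2 same_block q -> p = q.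
Proof.
have eq_pb r : blocks r = equivalence_partition (fun x y : T => y \in pblock (blocks r) x) [set: T].
  by rewrite equivalence_partition_pblock ?blocksP.
move=> eqpq; apply: val_inj => /=; rewrite (eq_pb p) (eq_pb q).
rewrite /equivalence_partition; apply: eq_imset => x; apply/setP=> y.
by rewrite !inE; have := eqpq x y; rewrite /same_block /= => ->.
Qed.

Lemma fibre_part_inj (T : finType) (rT rT' : eqType) (f : T -> rT) (g : T -> rT') :
  (forall x y, (f x == f y) = (g x == g y)) -> fibre_part f = fibre_part g.
Proof. by move=> e; apply: setpart_inj => x y; rewrite !same_block_fibre. Qed.

Definition lab N k l (i : midx N k) (j : midx N l) (x : points k l) : 'I_N :=
  match x with inl a => i a | inr b => j b end.

Lemma deltaP N k l (p : part k l) (i : midx N k) (j : midx N l) :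
  reflect (forall x y, same_block p x y -> lab i j x = lab i j y)
          (delta_part p i j).
Proof.
apply: (iffP forallP) => [H x y xy | H x].
  by have /forallP/(_ y)/implyP/(_ xy)/eqP := H x.
by apply/forallP => y; apply/implyP => /H e; apply/eqP.
Qed.

Lemma lab_surj N k l (f : points k l -> 'I_N) :
  exists i, exists j, lab i j =1 f.
Proof.
exists [ffun a => f (inl a)], [ffun b => f (inr b)].
by case=> a /=; rewrite ffunE.
Qed.

(** Two labels separate blocks: the indicator function of the block of x is
    constant on blocks. *)
Lemma same_block_delta k l (p : part k l) x y :
  (forall i j, @delta_part 2 k l p i j -> lab i j x = lab i j y) -> same_block p x y.
Proof.
have [i [j e]] := lab_surj (fun z => inord (same_block p x z) : 'I_2).
move=> /(_ i j); rewrite !e same_blockxx => H.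
have: inord true = inord (same_block p x y) :> 'I_2.
  apply: H; apply/deltaP => a b ab; rewrite !e; congr (inord (nat_of_bool _)).
  apply/idP/idP => h; first exact: same_block_trans ab.
  by apply: same_block_trans h _; rewrite same_block_sym.
by case: (same_block p x y) => // /(congr1 val) /=; rewrite !inordK.
Qed.

(** Identities between partitions thus become identities between relations. *)
Lemma delta_inj k l (p q : part k l) :
  (forall i j, @delta_part 2 k l p i j = delta_part q i j) -> p = q.
Proof.
move=> H; apply: setpart_inj => x y; apply/idP/idP => h.
  by apply: same_block_delta => i j; rewrite -H => /deltaP; apply.
by apply: same_block_delta => i j; rewrite H => /deltaP; apply.
Qed.

Lemma delta_pinv N k l (p : part k l) (i : midx N k) (j : midx N l) :
  delta_part (pinv p) j i = delta_part p i j.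
Proof.
apply/deltaP/deltaP => H x y xy.
  have := H (swap_row x) (swap_row y).
  rewrite same_block_fibre -same_blockE.
  have sw z : swap_row (swap_row z) = z :> points k l by case: z.
  by rewrite !sw => /(_ xy); case: (x) (y) => ? [] ?.
have := H (swap_row x) (swap_row y).
rewrite same_blockE; rewrite same_block_fibre in xy => /(_ xy).
by case: (x) (y) => ? [] ?.
Qed.

Lemma pinvK k l (p : part k l) : pinv (pinv p) = p.
Proof. by apply: delta_inj => i j; rewrite !delta_pinv. Qed.

Lemma delta_rperm N n (s : 'S_n) (i j : midx N n) :
  delta_part (rperm s) i j = [forall a, i a == j (s a)].
Proof.
apply/deltaP/forallP => [H a | H x y].
  by apply/eqP; have := H (inl a) (inr (s a)); rewrite same_block_fibre; apply.
rewrite same_block_fibre.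
have e z : lab i j z = j (match z with inl a => s a | inr b => b end).
  by case: z => a //=; apply/eqP.
by move/eqP=> h; rewrite !e h.
Qed.

Lemma delta_rperm1 N n (i j : midx N n) :
  delta_part (rperm 1%g) i j = (i == j).
Proof.
rewrite delta_rperm; apply/forallP/eqP => [H | -> a]; last by rewrite perm1.
by apply/ffunP => a; have := H a; rewrite perm1 => /eqP.
Qed.

Section Stack.
Variables (k l m : nat) (p : part k l) (q : part l m).

Lemma stacked_sym : symmetric (stacked p q).
Proof.
have H (T : finType) (r : setpart T) a b : osame_block r a b = osame_block r b a.
  by case: a b => [a|] [b|] //=; apply: same_block_sym.
by move=> x y; rewrite /stacked /= [osame_block p _ _]H [osame_block q _ _]H.
Qed.

Lemma same_block_pcomp x y :
  same_block (pcomp q p) x y = connect (stacked p q) (outer l x) (outer l y).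
Proof.
rewrite same_block_fibre fingraph.root_connect //.
exact: sym_connect_sym stacked_sym.
Qed.

Definition lab3 N (i : midx N k) (h : midx N l) (j : midx N m) (z : 'I_k + 'I_l + 'I_m) : 'I_N :=
  match z with inl (inl a) => i a | inl (inr b) => h b | inr c => j c end.

(** A labelling of the outer points extends to the middle row by propagating
    labels along the connected components of the stacked diagram; components
    contained in the middle row receive the label [ord0]. *)
Lemma delta_pcomp N (i : midx N.+1 k) (j : midx N.+1 m) :
  delta_part (pcomp q p) i j = [exists h, delta_part p i h && delta_part q h j].
Proof.
apply/idP/existsP; last first.
  move=> [h /andP[/deltaP Hp /deltaP Hq]]; apply/deltaP => x y.
  rewrite same_block_pcomp.
  have e z : lab i j z = lab3 i h j (outer l z) by case: z.
  rewrite !e => /connectP[c]; elim: c (outer l x) => [|a c IH] z /=; first by move=> _ ->.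
  move=> /andP[za ac] /(IH _ ac) <-.
  case/orP: za => {e IH ac}.
    by case: z a => [z|?] [a|?] //= /Hp; case: z a => ? [] ?.
  by case: z a => [[?|z]|z] [[?|a]|a] //= /Hq.
move=> /deltaP H.
(* A middle point takes the label of any outer point of its component. *)
pose L z := if [pick x : points k m | connect (stacked p q) (outer l x) z] is Some x
            then lab i j x else ord0.
have Lo x : L (outer l x) = lab i j x.
  rewrite /L; case: pickP => [y|/(_ x)]; last by rewrite connect0.
  by rewrite -same_block_pcomp => /H.
have Lc y z : stacked p q y z -> L y = L z.
  move=> yz; have cyz := connect1 yz.
  have czy : connect (stacked p q) z y by rewrite (sym_connect_sym stacked_sym).
  rewrite /L; case: pickP => [x xy|H1]; case: pickP => [x' xz|H2] //.
  - by apply: H; rewrite same_block_pcomp (connect_trans xy) // (sym_connect_sym stacked_sym) (connect_trans xz).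
  - by have := H2 x; rewrite (connect_trans xy).
  - by have := H1 x'; rewrite (connect_trans xz).
exists [ffun b => L (inl (inr b))]; apply/andP; split; apply/deltaP => x y xy.
  have e z : lab i [ffun b => L (inl (inr b))] z = L (inl z).
    by case: z => [a|b] /=; rewrite ?ffunE // (Lo (inl a)).
  by rewrite !e; apply: Lc; rewrite /stacked /= [same_block _ _ _]xy.
pose emb (z : points l m) : 'I_k + 'I_l + 'I_m := match z with inl b => inl (inr b) | inr c => inr c end.
have e z : lab [ffun b => L (inl (inr b))] j z = L (emb z).
  by case: z => [a|b] /=; rewrite ?ffunE // (Lo (inr b)).
rewrite !e; apply: Lc; rewrite /stacked /=; apply/orP; right.
by case: (x) (y) xy => ? [] ?.
Qed.
End Stack.

Lemma delta_pcompP N k l m (p : part k l) (q : part l m) (i : midx N.+1 k) (j : midx N.+1 m) :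
  reflect (exists2 h, delta_part p i h & delta_part q h j) (delta_part (pcomp q p) i j).
Proof.
rewrite delta_pcomp; apply: (iffP existsP) => [[h /andP[]]|[h h1 h2]]; first by exists h.
by exists h; rewrite h1.
Qed.

Lemma pcompA k l m n (p : part k l) (q : part l m) (r : part m n) :
  pcomp r (pcomp q p) = pcomp (pcomp r q) p.
Proof.
apply: delta_inj => i j; apply/delta_pcompP/delta_pcompP.
  move=> [h /delta_pcompP[h' h1 h2] h3]; exists h' => //; apply/delta_pcompP; by exists h.
move=> [h h1 /delta_pcompP[h' h2 h3]]; exists h' => //; apply/delta_pcompP; by exists h.
Qed.

Lemma pinv_pcomp k l m (p : part k l) (q : part l m) :
  pinv (pcomp q p) = pcomp (pinv p) (pinv q).
Proof.
apply: delta_inj => i j; rewrite delta_pinv; apply/delta_pcompP/delta_pcompP;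
  move=> [h h1 h2]; exists h; rewrite ?delta_pinv // -delta_pinv //.
Qed.

Lemma pcomp1p k l (p : part k l) : pcomp (rperm 1%g) p = p.
Proof.
apply: delta_inj => i j; apply/delta_pcompP/idP => [[h ?]|?].
  by rewrite delta_rperm1 => /eqP<-.
by exists j; rewrite ?delta_rperm1.
Qed.

Lemma pinv_rperm n (s : 'S_n) : pinv (rperm s) = rperm s^-1%g.
Proof.
apply: delta_inj => i j; rewrite delta_pinv !delta_rperm; apply/forallP/forallP => H a.
  by rewrite eq_sym -{2}(permKV s a).
by rewrite eq_sym -{2}(permK s a).
Qed.

Lemma pcomp_rperm n (s t : 'S_n) : pcomp (rperm t) (rperm s) = rperm (s * t)%g.
Proof.
apply: delta_inj => i j; apply/delta_pcompP/idP.
  move=> [h]; rewrite !delta_rperm => /forallP H1 /forallP H2; apply/forallP => a.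
  by rewrite permM (eqP (H1 a)) (eqP (H2 _)).
rewrite delta_rperm => /forallP H; exists [ffun a => i (s^-1%g a)].
  by rewrite delta_rperm; apply/forallP => a; rewrite ffunE permK.
by rewrite delta_rperm; apply/forallP => a; rewrite ffunE (eqP (H _)) permM permKV.
Qed.

(** The relation of a partition is difunctional: a block meeting both rows
    sees the same label in the three labellings that are chained, and any other
    block sees only the first or only the last one. *)
Lemma pcomp_regular k l (p : part k l) : pcomp (pcomp p (pinv p)) p = p.
Proof.
apply: delta_inj => i j; apply/delta_pcompP/idP; last first.
  move=> h; exists j => //; apply/delta_pcompP; exists i => //.
  by rewrite delta_pinv.
move=> [j' /deltaP H1 /delta_pcompP[i']]; rewrite delta_pinv => /deltaP H2 /deltaP H3.
apply/deltaP => [[a|a] [b|b]] h.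
- exact: (H1 (inl a) (inl b)).
- have := H1 _ _ h; have := H2 _ _ h; have := H3 _ _ h => /= <- -> ->.
  by [].
- have := H1 _ _ h; have := H2 _ _ h; have := H3 _ _ h => /= -> <- ->.
  by [].
- exact: (H3 (inr a) (inr b)).
Qed.

(** * Projective partitions and their upper halves *)

Section Projective.
Variables (k : nat) (p : part k k).
Hypothesis pp : projective p.

Lemma projective_inv : pinv p = p.
Proof. by case/andP: pp => /eqP<-. Qed.

Lemma projective_idem : pcomp p p = p.
Proof. by case/andP: pp => _ /eqP<-. Qed.

Lemma same_block_swap x y :
  same_block p (swap_row x) (swap_row y) = same_block p x y.
Proof.
by rewrite -[in RHS]projective_inv same_block_fibre -same_blockE.
Qed.

(** By symmetry b is joined to a' as well, so that the middle point b' of p p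
    joins a to a'; now a' is joined to a, hence to b', and symmetry turns this
    into a block containing a and b. *)
Lemma same_block_through a b :
  same_block p (inl a) (inr b) -> same_block p (inl a) (inl b).
Proof.
move=> ab; have ba : same_block p (inl b) (inr a).
  by rewrite same_block_sym -same_block_swap.
have aa : same_block p (inl a) (inr a).
  rewrite -[X in same_block X _ _]projective_idem same_block_pcomp.
  apply: (@connect_trans _ _ (inl (inr b))); apply: connect1.
    by rewrite /stacked /= [same_block _ _ _]ab.
  by rewrite /stacked /= [same_block _ _ _]ba.
rewrite -same_block_swap /=; apply: same_block_trans ab.
by rewrite same_block_sym.
Qed.

(** Taken in increasing order, these points number the lower points of the upper
    half of p. *)
Definition block_rep : pred 'I_k := fun i =>
  through (pblock p (inl i)) &&
  [forall i', same_block p (inl i') (inl i) ==> (i <= i')%N].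

Lemma block_rep_inj i j :
  block_rep i -> block_rep j -> same_block p (inl i) (inl j) -> i = j.
Proof.
move=> /andP[_ /forallP Hi] /andP[_ /forallP Hj] ij; apply/val_inj/eqP.
rewrite eqn_leq; apply/andP; split.
  by apply: (implyP (Hi j)); rewrite same_block_sym.
by apply: (implyP (Hj i)).
Qed.

Lemma throughP a : reflect (exists b, same_block p (inl a) (inr b)) (through (pblock p (inl a))).
Proof.
apply: (iffP andP) => [[_ /existsP[b ab]] | [b ab]]; first by exists b.
by split; apply/existsP; [exists a; exact: same_blockxx | exists b].
Qed.

Lemma through_diag a : through (pblock p (inl a)) -> same_block p (inl a) (inr a).
Proof.
move=> /throughP[b ab]; apply: (same_block_trans ab).
by rewrite same_block_sym -same_block_swap /=; apply: same_block_through.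
Qed.

Lemma block_rep_ex a : through (pblock p (inl a)) ->
  exists2 r, block_rep r & same_block p (inl a) (inl r).
Proof.
move=> ta; pose P := [pred i : 'I_k | same_block p (inl a) (inl i)].
have Pa : P a by apply: same_blockxx.
case: (@arg_minnP _ a P (fun i => val i) Pa) => r /= ar Hr.
exists r => //; apply/andP; split; first by move: ar; rewrite same_blockE => /eqP<-.
apply/forallP => i; apply/implyP => ir; apply: Hr.
by apply: same_block_trans ar _; rewrite same_block_sym.
Qed.

Lemma card_block_rep : #|[set i | block_rep i]| = nthrough p.
Proof.
rewrite -(@card_in_imset _ _ (fun i : 'I_k => pblock p (inl i))).
  congr #|pred_of_set _|; apply/setP => B; rewrite inE; apply/imsetP/andP.
    case=> i; rewrite inE => /andP[ti _] ->; split=> //.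
    by rewrite pblock_mem // (cover_partition (blocksP p)) inE.
  move=> [BP tB]; have /andP[/existsP[a aB] _] := tB.
  have tI : trivIset p by case/and3P: (blocksP p).
  have eB := def_pblock tI BP aB; rewrite -eB in tB.
  have [r rr ar] := block_rep_ex tB; exists r; rewrite ?inE //.
  by rewrite -eB; apply/eqP; rewrite -same_blockE.
move=> i j; rewrite !inE => ri rj /eqP; rewrite -same_blockE => ij.
exact: block_rep_inj ij.
Qed.

Lemma size_block_reps : nthrough p = size [seq i <- enum 'I_k | block_rep i].
Proof. by rewrite -card_block_rep cardsE cardE enumT. Qed.

Definition nth_rep (j : 'I_(nthrough p)) : 'I_k :=
  tnth (in_tuple [seq i <- enum 'I_k | block_rep i]) (cast_ord size_block_reps j).

Lemma nth_repP j : block_rep (nth_rep j).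
Proof.
by have := mem_tnth (cast_ord size_block_reps j) (in_tuple [seq i <- enum 'I_k | block_rep i]);
  rewrite mem_filter => /andP[].
Qed.

Lemma nth_rep_mono (a b : 'I_(nthrough p)) : (a < b)%N -> (nth_rep a < nth_rep b)%N.
Proof.
move=> ab; set s := [seq i <- enum 'I_k | block_rep i].
have Hs : sorted (relpre val ltn) s.
  apply: sorted_filter; first by move=> x y z /=; apply: ltn_trans.
  by rewrite -sorted_map val_enum_ord iota_ltn_sorted.
rewrite /nth_rep !(tnth_nth (nth_rep a)) /=.
apply: (sorted_ltn_nth (leT := relpre val ltn)) => //; rewrite ?inE -?size_block_reps //.
by move=> x y z /=; apply: ltn_trans.
Qed.

Lemma nth_rep_surj r : block_rep r -> exists j, nth_rep j = r.
Proof.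
move=> rr; have: r \in in_tuple [seq i <- enum 'I_k | block_rep i].
  by rewrite mem_filter rr mem_enum.
case/tnthP => j ->; exists (cast_ord (esym size_block_reps) j).
by rewrite /nth_rep cast_ordKV.
Qed.

Lemma nth_rep_inj : injective nth_rep.
Proof.
move=> a b eab; apply/val_inj/eqP; case: ltngtP => // /nth_rep_mono; by rewrite eab ltnn.
Qed.

Definition upper_part : part k (nthrough p) :=
  fibre_part (fun x : points k (nthrough p) =>
    pblock p (inl (match x with inl i => i | inr j => nth_rep j end))).

Lemma min_up_rep j : min_up upper_part j = nth_rep j.
Proof.
rewrite /min_up; have bj := nth_repP j; set r := nth_rep j in bj *.
have rP i : same_block upper_part (inr j) (inl i) -> (r <= i)%N.
  rewrite same_block_fibre -same_blockE => ri; case/andP: bj => _ /forallP/(_ i)/implyP.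
  by apply; rewrite same_block_sym.
have rr : same_block upper_part (inr j) (inl r) by rewrite same_block_fibre.
apply/eqP; rewrite eqn_leq; apply/andP; split; last first.
  by apply: (big_ind (fun n => (r <= n)%N)) => //; [exact: ltnW | move=> x y; rewrite leq_min => -> ].
have: r \in index_enum 'I_k by rewrite mem_index_enum.
elim: (index_enum 'I_k) => // a s IH; rewrite inE big_cons.
case/orP => [/eqP<- | /IH H]; first by rewrite rr geq_minl.
by case: ifP => // _; rewrite geq_min H orbT.
Qed.

Lemma building_upper_part : building upper_part.
Proof.
apply/and3P; split.
- apply/forallP => a; apply/forallP => b; apply/implyP; apply: contra => ab.
  rewrite same_block_fibre -same_blockE in ab.
  by apply/eqP/nth_rep_inj/block_rep_inj => //; apply: nth_repP.
- apply/forallP => j; apply/existsP; exists (nth_rep j).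
  by rewrite same_block_fibre.
- apply/forallP => a; apply/forallP => b; apply/implyP; rewrite !min_up_rep.
  exact: nth_rep_mono.
Qed.

(** A through-block of a projective partition is symmetric under exchange of
    the rows, so that it is recovered from its upper half by joining the latter
    to its own reflection. *)
Lemma upper_part_comp : p = pcomp (pinv upper_part) upper_part.
Proof.
have rep_diag j : same_block p (inl (nth_rep j)) (inr (nth_rep j)).
  by apply: through_diag; case/andP: (nth_repP j).
apply: delta_inj => i j; apply/idP/delta_pcompP => [/deltaP H | [h /deltaP H1]].
  exists [ffun c => i (nth_rep c)]; rewrite ?delta_pinv; apply/deltaP => x y;
    rewrite same_block_fibre -same_blockE => xy.
    by have := H _ _ xy; case: (x) (y) => ? [] ? /=; rewrite ?ffunE.
  rewrite -same_block_swap in xy; have := H _ _ xy.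
  have hd c : i (nth_rep c) = j (nth_rep c) by apply: (H _ _ (rep_diag c)).
  by move: (x) (y) => [?|?] [?|?] /=; rewrite ?ffunE ?hd.
rewrite delta_pinv => /deltaP H2; apply/deltaP.
have cross a b : same_block p (inl a) (inr b) -> i a = j b.
  move=> ab; have tha : through (pblock p (inl a)) by apply/throughP; exists b.
  have [r rr ar] := block_rep_ex tha; have [c ec] := nth_rep_surj rr.
  have := H1 (inl a) (inr c); rewrite same_block_fibre -same_blockE ec => /(_ ar) /= ->.
  have := H2 (inl b) (inr c); rewrite same_block_fibre -same_blockE ec /= => -> //.
  by apply: same_block_trans ar; rewrite same_block_sym same_block_through.
move=> [a|a] [b|b] ab /=.
- by apply: (H1 (inl a) (inl b)); rewrite same_block_fibre -same_blockE.
- exact: cross.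
- by symmetry; apply: cross; rewrite same_block_sym.
- by apply: (H2 (inl a) (inl b)); rewrite same_block_fibre -same_blockE -same_block_swap.
Qed.

Lemma upartP : building (upart p) /\ p = pcomp (pinv (upart p)) (upart p).
Proof.
rewrite /upart; case: pickP => [s /andP[sb /eqP e] //|/(_ upper_part)].
by rewrite building_upper_part -upper_part_comp eqxx.
Qed.

End Projective.

Section Building.
Variables (k l : nat) (s : part k l).
Hypothesis bs : building s.

Lemma building_delta_inj N (i : midx N k) (h h' : midx N l) :
  delta_part s i h -> delta_part s i h' -> h = h'.
Proof.
move=> /deltaP H /deltaP H'; apply/ffunP => j.
case/and3P: bs => _ /forallP/(_ j)/existsP[a ja] _.
by have := H _ _ ja => /= ->; have := H' _ _ ja => /= ->.
Qed.

Lemma building_delta_ex N (h : midx N.+1 l) : exists i, delta_part s i h.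
Proof.
have sep a b : same_block s (inr a) (inr b) -> a = b.
  case/and3P: bs => /forallP/(_ a)/forallP/(_ b)/implyP H _ _ ab.
  by apply/eqP/negPn/negP => /H; rewrite ab.
pose L x := if [pick j | same_block s x (inr j)] is Some j then h j else ord0.
have LE x y : same_block s x y -> L x = L y.
  move=> xy; rewrite /L; congr (match _ with Some j => _ | None => _ end).
  apply: eq_pick => j /=; apply/idP/idP; last exact: same_block_trans xy.
  by apply: same_block_trans; rewrite same_block_sym.
exists [ffun a => L (inl a)]; apply/deltaP => x y xy.
have e z : lab [ffun a => L (inl a)] h z = L z.
  case: z => [a|b] /=; rewrite ?ffunE // /L; case: pickP => [j /sep -> //|/(_ b)].
  by rewrite same_blockxx.
by rewrite !e; apply: LE.
Qed.

(** The labels of the lower points are read off from upper points, and they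
    are independent because the lower points lie in different blocks. *)
Lemma building_coisometry : pcomp s (pinv s) = rperm 1%g.
Proof.
apply: delta_inj => i j; rewrite delta_rperm1; apply/delta_pcompP/eqP.
  by move=> [h]; rewrite delta_pinv; apply: building_delta_inj.
move=> <-; have [h H] := building_delta_ex i; by exists h; rewrite ?delta_pinv.
Qed.

End Building.

(** Two lower points in one block could not carry different labels, and the
    label of a lower point joined to no upper point could change across the
    composition. Hence the lower points choose pairwise different upper points,
    and all upper points are chosen since both rows have n points. *)
Lemma coisometry_perm n (s : part n n) :
  pcomp s (pinv s) = rperm 1%g -> exists t : 'S_n, s = rperm t.
Proof.
move=> e.
have E (i j : midx 2 n) : delta_part (pcomp s (pinv s)) i j = (i == j) by rewrite e delta_rperm1.
have sep a b : same_block s (inr a) (inr b) -> a = b.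
  move=> ab; pose h : midx 2 n := [ffun c => inord (c == a)].
  have /delta_pcompP[i _ /deltaP H] : delta_part (pcomp s (pinv s)) h h by rewrite E.
  have := H _ _ ab; rewrite /= !ffunE eqxx => /(congr1 val) /=; rewrite !inordK //.
    by case: eqP.
  by case: (b == a).
have ex a : exists b, same_block s (inr a) (inl b).
  case: (pickP (fun b => same_block s (inr a) (inl b))) => [b|no]; first by exists b.
  pose h : midx 2 n := [ffun c => inord (c == a)]; pose z : midx 2 n := [ffun c => ord0].
  have: delta_part (pcomp s (pinv s)) h z.
    apply/delta_pcompP; exists z; rewrite ?delta_pinv; apply/deltaP => x y xy; last first.
      by case: (x) (y) => ? [] ? /=; rewrite !ffunE.
    suff L w : lab z h w = inord (same_block s (inr a) w).
      rewrite !L; congr (inord (nat_of_bool _)); apply/idP/idP => H.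
        exact: same_block_trans xy.
      by apply: (same_block_trans H); rewrite same_block_sym.
    case: w => [b|b] /=; rewrite ffunE; first by rewrite no; apply: val_inj; rewrite /= inordK.
    congr (inord (nat_of_bool _)); apply/eqP/idP => [->|/sep //]; exact: same_blockxx.
  rewrite E => /eqP/ffunP/(_ a); rewrite !ffunE eqxx => /(congr1 val) /=.
  by rewrite inordK.
have [f Hf] : exists f : 'I_n -> 'I_n, forall a, same_block s (inr a) (inl (f a)).
  exists (fun a => xchoose (ex a)) => a; exact: (xchooseP (ex a)).
have fI : injective f.
  move=> a b eab; apply: sep; apply: (same_block_trans (Hf a)).
  by rewrite eab same_block_sym.
exists (perm fI)^-1%g; apply: setpart_inj => x y.
pose g (w : points n n) := match w with inl i => (perm fI)^-1%g i | inr j => j end.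
have gP w : same_block s w (inr (g w)).
  case: w => [i|j] /=; last exact: same_blockxx.
  by rewrite same_block_sym -{2}(permKV (perm fI) i) permE.
rewrite same_block_fibre -/(g x) -/(g y).
have := gP x; have := gP y; rewrite !same_blockE => /eqP-> /eqP->.
rewrite -same_blockE; apply/idP/eqP => [/sep //|->]; exact: same_blockxx.
Qed.

Lemma rperm1_in (K : category) n : rperm 1%g \in K n n.
Proof.
elim: n => [|n IH].
  have e : forall (q r : part 0 0), q = r.
    by move=> q r; apply: setpart_inj => [[[]|[]]].
  have H := @cat_up_left K 1 0 _ (cat_id K).
  by have := cat_comp (cat_inv H) H; rewrite (e (pcomp _ _) (rperm 1%g)).
suff E : ptensor pid (rperm 1%g : part n n) = (rperm 1%g : part n.+1 n.+1).
  by have := cat_tensor (cat_id K) IH; rewrite E.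
rewrite /ptensor {2}/rperm; apply: fibre_part_inj => x y.
pose g (z : points n.+1 n.+1) : 'I_n.+1 := match z with inl i => i | inr j => j end.
have pb m (z w : points m m) : (pblock (rperm 1%g : part m m) z == pblock (rperm 1%g : part m m) w) = 
   (match z with inl i => i | inr j => j end == match w with inl i => i | inr j => j end).
  by rewrite -same_blockE same_block_fibre; case: z w => [a|a] [b|b]; rewrite ?perm1.
pose G (z : points n.+1 n.+1) := match split (g z : 'I_(1 + n)) with
   inl a => inl (pblock (rperm 1%g : part 1 1) (inl a)) | inr b => inr (pblock (rperm 1%g : part n n) (inl b)) end.
have GE z : ptensor_fun pid (rperm 1%g) z = G z.
  case: z => [a|a]; rewrite /G /=; case: (split _) => b //.
    by congr (inl _); apply/eqP; rewrite pb.
  by congr (inr _); apply/eqP; rewrite pb.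
have gE z : match z with inl i => (1%g : 'S_n.+1) i | inr j => j end = g z.
  by case: z => // a; rewrite perm1.
rewrite !GE !gE /G; have -> : (g x == g y) = (split (g x : 'I_(1 + n)) == split (g y : 'I_(1 + n))).
  by rewrite (inj_eq (can_inj (@splitK 1 n))).
case: (split _) => a; case: (split _) => b //; rewrite /eq_op /=.
  exact: (pb 1 (inl a) (inl b)).
exact: (pb n (inl a) (inl b)).
Qed.

(** * Order and symmetries of projective partitions *)

Opaque Defs.pcomp pinv rperm ptensor fibre_part.

Section PSigma.
Variables (k : nat) (p : part k k).
Hypothesis pp : projective p.

Lemma upart_building : building (upart p). Proof. by case: (upartP pp). Qed.
Lemma upart_comp : pcomp (pinv (upart p)) (upart p) = p.
Proof. by case: (upartP pp). Qed.
Lemma upart_coisometry : pcomp (upart p) (pinv (upart p)) = rperm 1%g.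
Proof. exact: building_coisometry upart_building. Qed.

Lemma psigma1 : psigma p 1%g = p.
Proof. by rewrite /psigma pcomp1p upart_comp. Qed.

Lemma psigmaM s t : pcomp (psigma p t) (psigma p s) = psigma p (s * t)%g.
Proof.
rewrite /psigma -!pcompA [pcomp (upart p) (pcomp (pinv _) _)]pcompA upart_coisometry pcomp1p.
by rewrite [pcomp (rperm t) _]pcompA pcomp_rperm.
Qed.

Lemma psigmaV s : pinv (psigma p s) = psigma p s^-1%g.
Proof. by rewrite /psigma !pinv_pcomp pinv_rperm pinvK pcompA. Qed.

Lemma pcomp_psigma s : pcomp p (psigma p s) = psigma p s.
Proof. by rewrite -{1}psigma1 psigmaM mulg1. Qed.

(** With w the upper half of p, the partition r is the composition of [pinv w],
    w r [pinv w] and w, and the middle factor is again a coisometry, now between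
    t(p) points. *)
Lemma corner_coisometry r : pcomp p (pcomp r p) = r ->
  pcomp r (pinv r) = p -> exists s, r = psigma p s.
Proof.
move=> rE rr; set w := upart p; pose m := pcomp w (pcomp r (pinv w)).
have wp : pcomp w p = w.
  transitivity (pcomp w (pcomp (pinv w) w)); first by congr pcomp; rewrite upart_comp.
  by rewrite pcompA upart_coisometry pcomp1p.
have [|s sE] := @coisometry_perm _ m.
  rewrite /m !pinv_pcomp pinvK !pcompA -[pcomp (pcomp (pcomp w r) _) w]pcompA upart_comp.
  have -> : pcomp (pcomp w r) p = pcomp w r.
    rewrite -pcompA; congr (pcomp w _).
    by rewrite -[in LHS]rE -!pcompA (projective_idem pp).
  by rewrite -[pcomp (pcomp w r) _]pcompA rr wp upart_coisometry.
exists s; rewrite /psigma -sE /m !pcompA upart_comp -!pcompA upart_comp.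
by rewrite rE.
Qed.
End PSigma.

(** Partitions behave like partial isometries, by [pcomp_regular]. *)
Lemma projective_gram k l (r : part k l) : projective (pcomp r (pinv r)).
Proof.
by rewrite /projective pinv_pcomp pinvK eqxx /= [pcomp (pcomp _ _) _]pcompA pcomp_regular.
Qed.

Opaque projective.

Lemma pcomp_conj_cancel k (p q a a' : part k k) :
  pcomp a' a = p -> pcomp p a = a -> pcomp p q = q -> pcomp q p = q ->
  pcomp a (pcomp q a') = p -> q = p.
Proof.
move=> aa pa pq qp E.
have H : pcomp a' (pcomp (pcomp a (pcomp q a')) a) = q.
  by rewrite !pcompA aa pq -pcompA aa.
by rewrite -H E pa aa.
Qed.

Section Order.
Variable k : nat.
Implicit Types p q r : part k k.

Lemma preceq_trans p q r : preceq r q -> preceq q p -> preceq r p.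
Proof. by move=> /eqP rq /eqP qp; rewrite /preceq -rq pcompA qp. Qed.

Lemma preceqV p q : projective p -> projective q -> preceq q p -> pcomp q p = q.
Proof.
by move=> pp qp /eqP/(congr1 (@pinv k k)); rewrite pinv_pcomp !projective_inv.
Qed.

Lemma preceq_anti p q : projective p -> projective q ->
  preceq q p -> preceq p q -> p = q.
Proof. by move=> pp qp /(preceqV pp qp) H /eqP E; rewrite -H E. Qed.

Lemma prec_trans p q r : projective p -> projective q ->
  prec r q -> prec q p -> prec r p.
Proof.
move=> pp pq /andP[rq nrq] /andP[qp' nqp].
rewrite /prec (preceq_trans rq qp') /=; apply: contra nqp => /eqP rp.
rewrite rp in rq; exact/eqP/(preceq_anti pq pp rq qp').
Qed.

(** The order is well founded since the number of projective partitions
    strictly below p decreases. *)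
Lemma Proj_ind (K : category) (P : part k k -> Prop) :
  (forall p, p \in Proj K k -> (forall q, q \in Proj K k -> prec q p -> P q) -> P p) ->
  forall p, p \in Proj K k -> P p.
Proof.
move=> H p; pose down p := [set q in Proj K k | prec q p].
have [n] := ubnP #|down p|; elim: n p => // n IH p; rewrite ltnS => le_n pK.
apply: H => // q qK qp; apply: IH => //; apply: leq_trans le_n.
have /setIdP[_ pp'] := pK; have /setIdP[_ qp'] := qK.
apply/proper_card/properP; split.
  apply/subsetP => r /setIdP[rK rq]; apply/setIdP; split; first exact: rK.
  exact: (prec_trans pp' qp' rq qp).
exists q; first by apply/setIdP.
by apply/negP => /setIdP[_]; rewrite /prec eqxx andbF.
Qed.

End Order.

Section Category.
Variable K : category.

Lemma ProjP k (p : part k k) : reflect (p \in K k k /\ projective p) (p \in Proj K k).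
Proof. by rewrite inE; apply: andP. Qed.

Lemma rperm1_Proj n : rperm 1%g \in Proj K n.
Proof.
apply/ProjP; split; first exact: rperm1_in.
by have := projective_gram (rperm 1%g : part n n); rewrite pinv_rperm invg1 pcomp1p.
Qed.

Section Fix.
Variables (k : nat) (p : part k k).
Hypothesis pK : p \in Proj K k.

Let pp : projective p. Proof. by case/ProjP: pK. Qed.
Let pKk : p \in K k k. Proof. by case/ProjP: pK. Qed.

Lemma SymP s : reflect (psigma p s \in K k k) (s \in Sym K p).
Proof.
rewrite /Sym /= gen_set_id ?inE; first exact: idP.
apply/group_setP; split; first by rewrite inE psigma1.
move=> x y; rewrite !inE => xK yK; rewrite -(psigmaM pp).
exact: (cat_comp xK yK).
Qed.

(** The composition q of p r p with its adjoint plays the part of a range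
    projection: if it is p then p r p is a symmetry of p, and otherwise q lies
    strictly below p and absorbs p r p. *)
Lemma corner_cases r : r \in K k k ->
  let r' := pcomp p (pcomp r p) in
  (exists2 s, s \in Sym K p & r' = psigma p s) \/
  (exists2 q, q \in Proj K k & prec q p /\ pcomp q r' = r').
Proof.
move=> rK r'; have pi := projective_idem pp.
have r'K : r' \in K k k by rewrite /r' !cat_comp ?pKk.
pose q := pcomp r' (pinv r').
have qK : q \in Proj K k.
  apply/ProjP; split; first exact: (cat_comp (cat_inv r'K) r'K).
  exact: projective_gram.
have [qp|nqp] := eqVneq q p.
  left; have [|s sE] := @corner_coisometry _ _ pp r' _ qp.
    by rewrite /r' -!pcompA pi pcompA pi.
  by exists s => //; apply/SymP; rewrite -sE.
right; exists q; first exact: qK.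
split; last exact: pcomp_regular.
by rewrite /prec nqp andbT /preceq /q pcompA /r' [pcomp p (pcomp p _)]pcompA pi.
Qed.

(** The conjugate of q by p_sigma is projective and below p; it cannot be p,
    since conjugating back would give q = p. *)
Lemma prec_conj q s : q \in Proj K k -> prec q p -> s \in Sym K p ->
  exists2 q', q' \in Proj K k & prec q' p /\
    pcomp q' (pcomp (psigma p s) q) = pcomp (psigma p s) q.
Proof.
move=> /ProjP[qK qp] /andP[/eqP qlep nqp] /SymP sK.
set ps := psigma p s; pose r := pcomp ps q.
have rr : pcomp r (pinv r) = pcomp ps (pcomp q (psigma p s^-1%g)).
  rewrite /r pinv_pcomp psigmaV (projective_inv qp) -/ps; move: (psigma p _) (ps) => a b.
  by rewrite pcompA -(pcompA q q b) (projective_idem qp) -pcompA.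
exists (pcomp r (pinv r)); last first.
  split; last exact: pcomp_regular.
  apply/andP; split; first by rewrite /preceq rr pcompA (pcomp_psigma pp).
  apply: contra nqp; rewrite rr => /eqP E.
  set ps' := psigma p s^-1%g in E.
  have ps'K : pcomp ps' ps = p by rewrite (psigmaM pp) mulgV (psigma1 pp).
  have qp' : pcomp q p = q by apply: (preceqV pp qp); apply/eqP.
  exact/eqP/(pcomp_conj_cancel ps'K (pcomp_psigma pp s) qlep qp' E).
have rK : r \in K k k by apply: cat_comp qK sK.
apply/ProjP; split; first exact: (cat_comp (cat_inv rK) rK).
exact: projective_gram.
Qed.
End Fix.
End Category.

(** * Star-closed matrix algebras *)

Section Adjoint.
Variable F : numClosedFieldType.

Lemma trmxCM m n p (A : 'M[F]_(m, n)) (B : 'M[F]_(n, p)) :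
  (A *m B)^t* = B^t* *m A^t*.
Proof. by rewrite trmx_mul map_mxM. Qed.

Lemma trmxCD m n (A B : 'M[F]_(m, n)) : (A + B)^t* = A^t* + B^t*.
Proof. by apply/matrixP => i j; rewrite !mxE rmorphD. Qed.

Lemma trmxCB m n (A B : 'M[F]_(m, n)) : (A - B)^t* = A^t* - B^t*.
Proof. by apply/matrixP => i j; rewrite !mxE rmorphB. Qed.

Lemma trmxCZ m n a (A : 'M[F]_(m, n)) : (a *: A)^t* = a^* *: A^t*.
Proof. by apply/matrixP => i j; rewrite !mxE rmorphM. Qed.

Lemma trmxC1 n : (1%:M : 'M[F]_n)^t* = 1%:M.
Proof. by rewrite trmx1 map_mx1. Qed.

Lemma trmxC0 m n : (0 : 'M[F]_(m, n))^t* = 0.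
Proof. by rewrite trmx0 map_mx0. Qed.

Lemma trmxC_sum m n (I : finType) (P : pred I) (f : I -> 'M[F]_(m, n)) :
  (\sum_(i | P i) f i)^t* = \sum_(i | P i) (f i)^t*.
Proof. exact: (big_morph (fun A : 'M[F]_(m, n) => A^t*) (@trmxCD m n) (@trmxC0 m n)). Qed.

Lemma trace_gram m n (Y : 'M[F]_(m, n)) :
  \tr (Y^t* *m Y) = \sum_i \sum_j `|Y j i| ^+ 2.
Proof.
apply: eq_bigr => i _; rewrite mxE; apply: eq_bigr => j _.
by rewrite !mxE normCK mulrC.
Qed.

Lemma trace_gram_ge0 m n (Y : 'M[F]_(m, n)) : 0 <= \tr (Y^t* *m Y).
Proof.
by rewrite trace_gram sumr_ge0 // => i _; rewrite sumr_ge0 // => j _; rewrite exprn_ge0.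
Qed.

Lemma trace_gram_eq0 m n (Y : 'M[F]_(m, n)) : \tr (Y^t* *m Y) = 0 -> Y = 0.
Proof.
rewrite trace_gram => H; apply/matrixP => j i; rewrite mxE; apply/eqP.
have H1 : \sum_j `|Y j i| ^+ 2 = 0.
  by apply: (psumr_eq0P _ H) => // a _; rewrite sumr_ge0 // => b _; rewrite exprn_ge0.
have /eqP : `|Y j i| ^+ 2 = 0 by apply: (psumr_eq0P _ H1) => // a _; rewrite exprn_ge0.
by rewrite expf_eq0 /= normr_eq0.
Qed.

Lemma gram_eq0 m n (Y : 'M[F]_(m, n)) : Y^t* *m Y = 0 -> Y = 0.
Proof. by move=> H; apply: trace_gram_eq0; rewrite H mxtrace0. Qed.

Lemma gram_sum_eq0 m n (I : finType) (P : pred I) (Y : I -> 'M[F]_(m, n)) :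
  \sum_(i | P i) (Y i)^t* *m Y i = 0 -> forall i, P i -> Y i = 0.
Proof.
move=> /(congr1 mxtrace); rewrite mxtrace0 raddf_sum => H i Pi.
apply: trace_gram_eq0; apply: (psumr_eq0P _ H) => // j _; exact: trace_gram_ge0.
Qed.

(** This [Q] is the coisometry used in the definition of subrepresentations. *)
Lemma proj_onb n (P : 'M[F]_n) : is_proj P ->
  let Q := schmidt (row_base P) in Q *m Q^t* = 1%:M /\ Q^t* *m Q = P.
Proof.
move=> [PP Ps] Q.
have QQ : Q *m Q^t* = 1%:M by apply/unitarymxP; rewrite schmidt_unitarymx // rank_leq_col.
split=> //; have /andP[/submxP[X QX] /submxP[Y PY]] : (Q == P)%MS.
  apply/eqmxP; apply: eqmx_trans (eq_row_base P); apply: eqmx_schmidt_free.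
  exact: row_base_free.
have QP : Q *m P = Q by rewrite QX -mulmxA PP.
have PQ : P *m (Q^t* *m Q) = P by rewrite {1}PY -mulmxA [Q *m (_ *m _)]mulmxA QQ mul1mx -PY.
have := congr1 (fun A => A^t*) PQ; rewrite trmxCM Ps trmxCM trmxCK -mulmxA QP.
by [].
Qed.

End Adjoint.

Definition matalg (F : numClosedFieldType) n (A : 'M[F]_n -> Prop) : Prop :=
  [/\ A 1%:M, forall a x y, A x -> A y -> A (a *: x + y),
      forall x y, A x -> A y -> A (x *m y) & forall x, A x -> A (x^t*)].

Section MatAlg.
Variables (F : numClosedFieldType) (n : nat) (A : 'M[F]_n -> Prop).
Hypothesis algA : matalg A.

Lemma matalg1 : A 1%:M. Proof. by case: algA. Qed.
Lemma matalgM x y : A x -> A y -> A (x *m y). Proof. by case: algA => _ _ + _; apply. Qed.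
Lemma matalgV x : A x -> A (x^t*). Proof. by case: algA => _ _ _; apply. Qed.
Lemma matalgL a x y : A x -> A y -> A (a *: x + y). Proof. by case: algA => _ + _ _; apply. Qed.
Lemma matalg0 : A 0.
Proof. by rewrite -(addNr (1%:M : 'M[F]_n)) -scaleN1r; apply: matalgL matalg1 matalg1. Qed.
Lemma matalgD x y : A x -> A y -> A (x + y).
Proof. by move=> ? ?; rewrite -[x]scale1r; apply: matalgL. Qed.
Lemma matalgZ a x : A x -> A (a *: x).
Proof. by move=> ?; rewrite -[_ *: _]addr0; apply: matalgL matalg0. Qed.
Lemma matalgB x y : A x -> A y -> A (x - y).
Proof. by move=> ? ?; rewrite addrC -scaleN1r; apply: matalgL. Qed.
Lemma matalg_sum (I : finType) (P : pred I) (f : I -> 'M[F]_n) :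
  (forall i, P i -> A (f i)) -> A (\sum_(i | P i) f i).
Proof. by move=> H; apply: big_ind => //; [exact: matalg0 | exact: matalgD]. Qed.

End MatAlg.

(** The range projection of y is a polynomial in y without constant term. By
    Cayley-Hamilton some polynomial annihilates y; as y is hermitian, y y b = 0
    implies y b = 0, so that powers of the variable can be removed until the
    constant term is nonzero. *)
Lemma range_proj (F : numClosedFieldType) n (A : 'M[F]_n -> Prop) (y : 'M[F]_n) :
  matalg A -> A y -> y^t* = y ->
  exists s, [/\ A s, is_proj (y *m s) & y *m (y *m s) = y].
Proof.
case: n A y => [|n] A y algA Ay ys.
  have z (a b : 'M[F]_0) : a = b by rewrite [a]flatmx0 [b]flatmx0.
  by exists y; split=> //; split; apply: z.
have Ahorner p : A (horner_mx y p).
  elim/poly_ind: p => [|p c IH]; first by rewrite rmorph0; apply: (matalg0 algA).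
  rewrite rmorphD rmorphM /= horner_mx_X horner_mx_C.
  apply: (matalgD algA); first exact: (matalgM algA).
  rewrite -scalemx1; apply: (matalgZ algA); exact: matalg1.
have comm p : y *m horner_mx y p = horner_mx y p *m y.
  have : horner_mx y ('X * p) = horner_mx y (p * 'X) by rewrite mulrC.
  by rewrite !rmorphM /= horner_mx_X.
have kill (B : 'M[F]_n.+1) : y *m (y *m B) = 0 -> y *m B = 0.
  by move=> H; apply: gram_eq0; rewrite trmxCM ys -mulmxA H mulmx0.
have [r r0 yr] : exists2 r : {poly F}, r`_0 != 0 & y *m horner_mx y r = 0.
  have : exists2 p : {poly F}, p != 0 & y *m horner_mx y p = 0.
    exists (char_poly y); first exact: monic_neq0 (char_poly_monic y).
    by rewrite Cayley_Hamilton mulmx0.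
  case=> p; have [m] := ubnP (size p); elim: m p => // m IH p; rewrite ltnS => sz p0 yp.
  have [p00|p00] := eqVneq p`_0 0; last by exists p.
  have /factor_theorem[q] : root p 0 by rewrite /root horner_coef0 p00.
  rewrite subr0 => pE; have q0 : q != 0 by apply: contraNneq p0 => q0; rewrite pE q0 mul0r.
  apply: (IH q) => //.
    by move: sz; rewrite pE size_mulX.
  by apply: kill; rewrite comm; move: yp; rewrite pE rmorphM /= horner_mx_X.
set c := r`_0 in r0.
have /factor_theorem[r1] : root (r - c%:P) 0.
  by rewrite /root !hornerE horner_coef0 subrr.
rewrite subr0 => /(canRL (subrK _)) rE.
pose s := - c^-1 *: horner_mx y r1.
have yys : y *m (y *m s) = y.
  have: y *m (y *m horner_mx y r1) = - c *: y.
    move: yr; rewrite rE rmorphD rmorphM /= horner_mx_X horner_mx_C.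
    rewrite mulmxDr mul_mx_scalar => /eqP; rewrite addr_eq0 => /eqP.
    by rewrite comm scaleNr.
  rewrite /s -!scalemxAr => ->; rewrite scalerA mulrNN mulVf //.
  by rewrite scale1r.
have ysc : y *m s = s *m y by rewrite /s -scalemxAr -scalemxAl comm.
exists s; split=> //; first exact: (matalgZ algA).
have ff : (y *m s) *m (y *m s) = y *m s by rewrite {1}ysc -mulmxA yys -ysc.
split=> //; have E : (y *m s)^t* = (y *m s)^t* *m (y *m s).
  by rewrite trmxCM ys -mulmxA yys.
move: (y *m s) E => f E.
have H : f^t*^t* = f^t* by rewrite [in LHS]E trmxCM trmxCK -E.
by rewrite -H trmxCK.
Qed.

(** Let a be an eigenvalue of e x e on the range of e. Then y = e x e - a e is
    not invertible there, so that the projection on its range lies strictly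
    below e. By minimality it vanishes, hence y = 0. *)
Lemma min_corner (F : numClosedFieldType) n (A : 'M[F]_n -> Prop) (e : 'M[F]_n) :
  matalg A -> is_proj e -> A e ->
  (forall f, is_proj f -> A f -> e *m f = f -> f = 0 \/ f = e) ->
  forall x, A x -> exists c, e *m x *m e = c *: e.
Proof.
move=> algA pe Ae emin x Ax; have [ee es] := pe.
have [e0|e0] := eqVneq e 0; first by exists 0; rewrite e0 mulmx0 scaler0.
set h := e *m x *m e; have he : h *m e = h by rewrite /h -mulmxA ee.
have eh : e *m h = h by rewrite /h !mulmxA ee.
have [r [Q [r0 QQ1 QQ2]]] : exists r (Q : 'M[F]_(r, n)),
    [/\ (0 < r)%N, Q *m Q^t* = 1%:M & Q^t* *m Q = e].
  exists (\rank e), (schmidt (row_base e)); have [? ?] := proj_onb pe.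
  by split; rewrite // lt0n mxrank_eq0.
have Qe : Q *m e = Q by rewrite -QQ2 mulmxA QQ1 mul1mx.
have Qh : Q *m h = Q *m h *m Q^t* *m Q by rewrite -mulmxA QQ2 -mulmxA he.
have [a /eigenvalueP[v vM v0]] := @eigenvalue_closed F _ (Q *m h *m Q^t*) r0.
pose u := v *m Q; have u0 : u != 0.
  by apply: contraNneq v0 => u0; rewrite -[v]mulmx1 -QQ1 mulmxA -/u u0 mul0mx.
have ue : u *m e = u by rewrite /u -mulmxA Qe.
(* The eigenvector v of e x e, seen in the range of e, is killed by y. *)
pose y := h - a *: e; have uy : u *m y = 0.
  by rewrite mulmxBr -scalemxAr ue /u -[v *m Q *m h]mulmxA Qh mulmxA vM -scalemxAl subrr.
have Ay : A y.
  by apply: (matalgB algA); [do 2?apply: (matalgM algA) | apply: (matalgZ algA)].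
have ey : e *m y = y by rewrite mulmxBr eh -scalemxAr ee.
exists a; apply/eqP; rewrite -subr_eq0 -/h -/y; apply/eqP.
have [||s [As pf zf]] := @range_proj F n A (y *m y^t*) algA.
- by apply: (matalgM algA) => //; apply: (matalgV algA).
- by rewrite trmxCM trmxCK.
have [||f0|fe] := emin _ pf.
- by apply: (matalgM algA) => //; apply: (matalgM algA) => //; apply: (matalgV algA).
- by rewrite !mulmxA ey.
- have y0 : y *m y^t* = 0 by rewrite -zf f0 mulmx0.
  by rewrite -[y]trmxCK [y^t*]gram_eq0 ?trmxC0 // trmxCK.
- by case/eqP: u0; rewrite -ue -fe !mulmxA uy !mul0mx.
Qed.

(** A matrix of maximal rank among those with rows in K spans K. *)
Lemma subspace_proj (F : numClosedFieldType) d (K : 'rV[F]_d -> Prop) :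
  K 0 -> (forall a x y, K x -> K y -> K (a *: x + y)) ->
  exists2 P : 'M[F]_d, is_proj P & forall x, K x <-> x *m P = x.
Proof.
move=> K0 Kl; pose ok r := `[< exists B : 'M[F]_d, (forall i, K (row i B)) /\ \rank B = r >].
have ok0 : exists r, ok r.
  by exists 0%N; apply/asboolP; exists 0; split; rewrite ?mxrank0 // => i; rewrite row0.
have okd r : ok r -> (r <= d)%N by move/asboolP=> [B [_ <-]]; apply: rank_leq_row.
case: (ex_maxnP ok0 okd) => r /asboolP[B [KB rB]] rmax.
have Kmul m (v : 'rV[F]_m) (C : 'M[F]_(m, d)) : (forall i, K (row i C)) -> K (v *m C).
  move=> KC; rewrite mulmx_sum_row; apply: (big_ind K) => // [x y Kx Ky|i _].
    by rewrite -[x]scale1r; apply: Kl.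
  by rewrite -[_ *: _]addr0; apply: Kl.
have KleB x : K x <-> (x <= B)%MS.
  split=> [Kx|/submxP[v ->]]; last exact: Kmul.
  have : \rank (B + x)%MS = \rank B.
    apply/eqP; rewrite eqn_leq andbC mxrankS ?addsmxSl //= rB; apply: rmax; apply/asboolP.
    exists (B + x)%MS; split=> // i.
    have /sub_addsmxP[[v w] /= ->] : (row i (B + x)%MS <= B + x)%MS by apply: row_sub.
    rewrite -[v *m B]scale1r; apply: Kl; first exact: Kmul.
    by apply: Kmul => j; rewrite (_ : row j x = x) // [j]ord1; apply/rowP => c; rewrite !mxE.
  move=> /eqP E; have := addsmxSl B x; move/mxrank_leqif_sup => H.
  by move: E; rewrite eq_sym H addsmx_sub submx_refl.
have uQ := schmidt_unitarymx (row_base B) (rank_leq_col B).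
set Q := schmidt _ in uQ; have /unitarymxP QQ := uQ.
exists (Q^t* *m Q).
  split; first by rewrite mulmxA -[_ *m Q *m _]mulmxA QQ mulmx1.
  by rewrite trmxCM trmxCK.
have QB : (Q :=: B)%MS.
  by apply: eqmx_trans (eq_row_base B); apply: eqmx_schmidt_free; apply: row_base_free.
move=> x; rewrite KleB -QB; split=> [/submxP[v ->]|<-].
  by rewrite mulmxA -[_ *m Q *m _]mulmxA QQ mulmx1.
by rewrite mulmxA submxMl.
Qed.

Lemma gram_scale_gt0 (F : numClosedFieldType) m n (Y : 'M[F]_(m, n)) (E : 'M[F]_n) c :
  is_proj E -> Y^t* *m Y = c *: E -> Y != 0 -> 0 < c.
Proof.
move=> [EE Es] YY Y0; have tE : 0 <= \tr E by rewrite -EE -{1}Es trace_gram_ge0.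
have : 0 < c * \tr E.
  rewrite -mxtraceZ -YY lt_def trace_gram_ge0 andbT.
  by apply: contraNneq Y0 => /trace_gram_eq0 ->.
have [-> |tE0] := eqVneq (\tr E) 0; first by rewrite mulr0 ltxx.
by rewrite pmulr_lgt0 // lt_def tE0.
Qed.

(** Since E is minimal, the part Y of X orthogonal to Q satisfies
    Y^t* Y = c E for a scalar c, which is positive unless Y = 0; then Y is a
    multiple of a partial isometry Z with source E. *)
Lemma greedy_step (F : numClosedFieldType) n (A : 'M[F]_n -> Prop) (Q E X : 'M[F]_n) :
  matalg A -> is_proj Q -> A Q -> is_proj E -> A X -> X *m E = X ->
  (forall x, A x -> exists c, E *m x *m E = c *: E) ->
  Q *m X = X \/
  exists Z, [/\ A Z, Z^t* *m Z = E, Q *m Z = 0 & (Q + Z *m Z^t*) *m X = X].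
Proof.
move=> algA [QQ Qs] AQ pE AX XE corner; have [EE Es] := pE.
pose Y := X - Q *m X.
have AY : A Y by apply: (matalgB algA) => //; apply: (matalgM algA).
have YE : Y *m E = Y by rewrite mulmxBl -mulmxA XE.
have QY : Q *m Y = 0 by rewrite mulmxBr mulmxA QQ subrr.
have EYs : E *m Y^t* = Y^t* by rewrite -{1}Es -trmxCM YE.
have [Y0|Y0] := eqVneq Y 0; first by left; apply/esym/eqP; rewrite -subr_eq0 -/Y Y0.
right; have [|c Hc] := corner (Y^t* *m Y).
  by apply: (matalgM algA) => //; apply: (matalgV algA).
have YY : Y^t* *m Y = c *: E by rewrite -Hc mulmxA EYs -mulmxA YE.
have c0 := gram_scale_gt0 pE YY Y0.
pose b := (sqrtC c)^-1; have bc : b^* * b * c = 1.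
  have -> : b^* = b by apply: CrealP; rewrite rpredV realE sqrtC_ge0 ltW.
  by rewrite /b -invfM -expr2 sqrtCK mulVf // gt_eqF.
exists (b *: Y); split.
- exact: (matalgZ algA).
- by rewrite trmxCZ -scalemxAl -scalemxAr YY !scalerA bc scale1r.
- by rewrite -scalemxAr QY scaler0.
have YQ : Y^t* *m Q = 0 by rewrite -{1}Qs -trmxCM QY trmxC0.
have YX : Y^t* *m X = c *: E.
  by rewrite -[X](subrK (Q *m X)) -/Y mulmxDr [Y^t* *m (Q *m X)]mulmxA YQ mul0mx addr0.
have ZX : (b *: Y) *m (b *: Y)^t* *m X = Y.
  rewrite trmxCZ -mulmxA -!scalemxAl YX scalerA -scalemxAr YE scalerA.
  by rewrite mulrA [b * _]mulrC bc scale1r.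
by rewrite mulmxDl ZX addrC subrK.
Qed.

(** * The maps T_p *)

Section Count.
Variable n : nat.
Local Notation N := n.+1.

Lemma delta0 k l (p : part k l) : delta_part p (0 : midx N k) (0 : midx N l).
Proof. by apply/deltaP => [[a|a] [b|b]] _ /=; rewrite !ffunE. Qed.

Lemma deltaD k l (p : part k l) (i i' : midx N k) (j j' : midx N l) :
  delta_part p i j -> delta_part p i' j' -> delta_part p (i + i') (j + j').
Proof.
move=> /deltaP H /deltaP H'; apply/deltaP => x y xy.
have e z : lab (i + i') (j + j') z = lab i j z + lab i' j' z.
  by case: z => a /=; rewrite ffunE.
by rewrite !e (H _ _ xy) (H' _ _ xy).
Qed.

Lemma deltaN k l (p : part k l) (i : midx N k) (j : midx N l) :
  delta_part p i j -> delta_part p (- i) (- j).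
Proof.
move=> /deltaP H; apply/deltaP => x y xy.
have e z : lab (- i) (- j) z = - lab i j z.
  by case: z => a /=; rewrite ffunE.
by rewrite !e (H _ _ xy).
Qed.

(** This is N to the number of closed loops of the stacked diagram: the loops
    are labelled freely and all other components by zero. *)
Definition nloop k l m (p : part k l) (q : part l m) : nat :=
  #|[set h : midx N l | delta_part p 0 h && delta_part q h 0]|.

Lemma nloop_gt0 k l m (p : part k l) (q : part l m) : (0 < nloop p q)%N.
Proof. by apply/card_gt0P; exists 0; rewrite inE !delta0. Qed.

(** Compatible labellings form a subgroup for addition modulo N, so that the
    labellings of the middle row extending (i, j) form a coset of those
    extending zero, unless there are none. *)
Lemma card_middle k l m (p : part k l) (q : part l m) (i : midx N k) (j : midx N m) :
  #|[set h : midx N l | delta_part p i h && delta_part q h j]| =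
    (delta_part (pcomp q p) i j * nloop p q)%N.
Proof.
case: delta_pcompP => [[h0 h1 h2]|no]; last first.
  rewrite mul0n; apply/eqP; rewrite cards_eq0; apply/eqP/setP => h; rewrite in_set0 in_set.
  by apply/negP => /andP[h1 h2]; apply: no; exists h.
rewrite mul1n /nloop -[RHS](card_imset _ (addrI h0)); apply: eq_card => h.
rewrite in_set; apply/andP/imsetP => [[a b]|[h']].
  exists (- h0 + h); last by rewrite addrA subrr add0r.
  rewrite in_set -(addNr i) -(addNr j).
  by apply/andP; split; apply: deltaD => //; apply: deltaN.
rewrite in_set => /andP[a b] ->.
by split; [rewrite -(addr0 i) | rewrite -(addr0 j)]; apply: deltaD.
Qed.

(** Both sides count the compatible labellings that vanish on the
    through-blocks, that is the functions on the remaining blocks. *)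
Lemma card_nbeta k l (p : part k l) :
  (#|[set i : midx N k | delta_part p i (0%R : midx N l)]| *
   #|[set j : midx N l | delta_part p (0%R : midx N k) j]|)%N = (N ^ nbeta p)%N.
Proof.
pose D := [set B in blocks p | ~~ through B].
have DP B : reflect (B \in blocks p /\ ~~ through B) (B \in D) by rewrite in_set; apply: andP.
have cD : #|D| = nbeta p.
  rewrite /nbeta /nblocks /nthrough -(cardsID [set B | through B] (blocks p)).
  have -> : blocks p :&: [set B | through B] = [set B in blocks p | through B].
    by apply/setP => B; rewrite !in_set.
  by rewrite addKn; apply: eq_card => B; rewrite !in_set andbC.
rewrite -cD -cardsX.
have -> : (N ^ #|D|)%N = #|[set g in pffun_on (0%R : 'I_N) (mem D) predT]|.
  have <- : #|pffun_on (0%R : 'I_N) (mem D) predT| = (N ^ #|D|)%N.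
    by rewrite card_pffun_on card_ord.
  by rewrite cardsE; apply: eq_card.
pose Phi (g : {ffun {set points k l} -> 'I_N}) : midx N k * midx N l :=
  ([ffun a => g (pblock p (inl a))], [ffun b => g (pblock p (inr b))]).
have tI : trivIset p by case/and3P: (blocksP p).
have pbP x : pblock p x \in blocks p.
  by rewrite pblock_mem // (cover_partition (blocksP p)) in_setT.
have PhiE g x : lab (Phi g).1 (Phi g).2 x = g (pblock p x).
  by case: x => a /=; rewrite ffunE.
have nt x y : same_block p x y -> pblock p x \in D ->
    match x, y with inl _, inl _ | inr _, inr _ => True | _, _ => False end.
  move=> xy /DP[_]; case: x y xy => [a|a] [b|b] // ab /negP[].
    by apply/andP; split; apply/existsP; [exists a; exact: same_blockxx|exists b].
  by apply/andP; split; apply/existsP; [exists b|exists a; exact: same_blockxx].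
have Dsupp g : g \in pffun_on (0%R : 'I_N) (mem D) predT -> forall B, B \notin D -> g B = 0.
  by case/pffun_onP => /subsetP H _ B; apply: contraNeq => /H.
rewrite -(card_in_imset (f := Phi)); last first.
  move=> g g'; rewrite !in_set => /Dsupp Hg /Dsupp Hg' e; apply/ffunP => B.
  have [BD|nBD] := boolP (B \in D); last by rewrite Hg ?Hg'.
  have [BP _] := DP _ BD.
  have /set0Pn[x xB] : B != set0.
    by apply: contraTneq BP => ->; case/and3P: (blocksP p).
  have BE : pblock p x = B by apply: def_pblock.
  by rewrite -BE -!PhiE e.
apply: eq_card => [[i j]]; apply/setXP/imsetP => /= [|[g]].
  rewrite !in_set => -[/deltaP Hi /deltaP Hj].
  pose g := [ffun B : {set points k l} => if B \in D then
      (if [pick x | x \in B] is Some x then lab i j x else 0) else 0].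
  exists g.
    rewrite in_set; apply/pffun_onP; split=> //; apply/subsetP => B.
    by rewrite inE /= ffunE; case: ifP => //; rewrite eqxx.
  have gE x : g (pblock p x) = lab i j x.
    rewrite ffunE; case: ifP => [BD|].
      case: pickP => [y xy|/(_ x)]; last by rewrite mem_pblock (cover_partition (blocksP p)) in_setT.
      have := nt _ _ xy BD; have := Hi _ _ xy; have := Hj _ _ xy.
      by move: (x) (y) => [?|?] [?|?].
    rewrite in_set pbP /= => /negbT; rewrite negbK => /andP[/existsP[a xa] /existsP[b xb]].
    have := Hi x (inr b) xb; have := Hj x (inl a) xa.
    by move: (x) => [?|?] /=; rewrite ?ffunE.
  by congr (_, _); apply/ffunP => a; rewrite ffunE gE.
rewrite in_set => /Dsupp Hg [-> ->]; rewrite !in_set; split; apply/deltaP => x y xy.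
  have e z : lab [ffun a => g (pblock p (inl a))] 0 z = if z is inl _ then g (pblock p z) else 0.
    by case: z => a /=; rewrite ffunE.
  rewrite !e; have exy : pblock p x = pblock p y by apply/eqP; rewrite -same_blockE.
  have [BD|/Hg BD] := boolP (pblock p x \in D).
    by have := nt _ _ xy BD; rewrite exy; case: x y {xy exy BD} => ? [] ?.
  by rewrite -exy BD; case: x y {xy exy BD} => ? [] ?.
have e z : lab 0 [ffun a => g (pblock p (inr a))] z = if z is inr _ then g (pblock p z) else 0.
  by case: z => a /=; rewrite ffunE.
rewrite !e; have exy : pblock p x = pblock p y by apply/eqP; rewrite -same_blockE.
have [BD|/Hg BD] := boolP (pblock p x \in D).
  by have := nt _ _ xy BD; rewrite exy; case: x y {xy exy BD} => ? [] ?.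
by rewrite -exy BD; case: x y {xy exy BD} => ? [] ?.
Qed.

End Count.

Lemma sum_enum_val (V : nmodType) (T : finType) (f : T -> V) :
  \sum_(i < #|T|) f (enum_val i) = \sum_x f x.
Proof. by rewrite [RHS](reindex _ (onW_bij _ (enum_val_bij T))). Qed.

Lemma psigma_delta n k (p : part k k) s (i j : midx n.+1 k) : projective p ->
  delta_part (psigma p s) i j = [exists h, delta_part (upart p) i h &&
     delta_part (upart p) j [ffun a => h (s^-1%g a)]].
Proof.
move=> pp; rewrite /psigma; apply/delta_pcompP/existsP => [[h' /delta_pcompP[h H1]]|[h /andP[H1 H2]]].
  rewrite delta_rperm delta_pinv => /forallP H2 H3; exists h; rewrite H1 /=.
  rewrite (_ : [ffun a => _] = h') //; apply/ffunP => a; rewrite ffunE.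
  by rewrite (eqP (H2 _)) permKV.
exists [ffun a => h (s^-1%g a)]; last by rewrite delta_pinv.
apply/delta_pcompP; exists h => //; rewrite delta_rperm; apply/forallP => a.
by rewrite ffunE permK.
Qed.

Section TMaps.
Variables (F : numClosedFieldType) (n : nat).
Local Notation N := n.+1.

Lemma TcircM k l m (p : part k l) (q : part l m) :
  Tcirc F N q *m Tcirc F N p = (nloop n p q)%:R *: Tcirc F N (pcomp q p).
Proof.
apply/matrixP => j i; rewrite !mxE.
pose f (h : midx N l) := (delta_part p (enum_val i) h && delta_part q h (enum_val j))%:R : F.
transitivity (\sum_h f h).
  rewrite -[RHS]sum_enum_val; apply: eq_bigr => h _; rewrite !mxE /f.
  by case: (delta_part p _ _); case: (delta_part q _ _); rewrite ?mulr0 ?mul0r ?mulr1.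
rewrite /f -natr_sum -natrM mulnC -card_middle; congr (_%:R).
by rewrite -sum1_card [RHS]big_mkcond /=; apply: eq_bigr => h _; rewrite in_set; case: (_ && _).
Qed.

Lemma TcircV k l (p : part k l) : (Tcirc F N p)^t* = Tcirc F N (pinv p).
Proof.
by apply/matrixP => j i; rewrite !mxE delta_pinv conjC_nat.
Qed.

Lemma Tcirc1 k : Tcirc F N (rperm 1%g : part k k) = 1%:M.
Proof.
by apply/matrixP => j i; rewrite !mxE delta_rperm1 eq_sym (inj_eq enum_val_inj).
Qed.

Lemma nbeta_scale k l (p : part k l) : (sqrtC N%:R : F) ^- nbeta p != 0.
Proof. by rewrite invr_eq0 expf_neq0 // sqrtC_eq0 pnatr_eq0. Qed.

(** The scalar is a power of the square root of N; being nonzero, it lets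
    absorption of partitions be read as absorption of maps. *)
Lemma TmapM k l m (p : part k l) (q : part l m) :
  exists2 c : F, c != 0 & Tmap F N q *m Tmap F N p = c *: Tmap F N (pcomp q p).
Proof.
exists ((sqrtC N%:R) ^- nbeta q * (sqrtC N%:R) ^- nbeta p * (nloop n p q)%:R *
        ((sqrtC N%:R) ^- nbeta (pcomp q p))^-1).
  have nz := (nbeta_scale p, nbeta_scale q, invr_neq0 (nbeta_scale (pcomp q p))).
  by rewrite !mulf_neq0 ?nz // pnatr_eq0 -lt0n nloop_gt0.
rewrite /Tmap -scalemxAl -scalemxAr TcircM !scalerA; congr (_ *: _).
by rewrite mulfVK ?nbeta_scale // mulrA.
Qed.

Lemma TmapV k l (p : part k l) :
  exists2 c : F, c != 0 & (Tmap F N p)^t* = c *: Tmap F N (pinv p).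
Proof.
exists (((sqrtC N%:R) ^- nbeta p)^* / (sqrtC N%:R) ^- nbeta (pinv p)).
  by rewrite mulf_neq0 ?conjC_eq0 ?nbeta_scale // invr_neq0 // nbeta_scale.
rewrite /Tmap linearZ /= map_mxZ TcircV scalerA mulfVK ?nbeta_scale //.
Qed.

Section Symmetry.
Variables (k : nat) (p : part k k).
Hypothesis pp : projective p.

Let M : nat := #|[set i : midx N k | delta_part (upart p) i 0%R]|.

Let upart0 (h : midx N (nthrough p)) : delta_part (upart p) 0 h -> h = 0.
Proof. by move=> H; exact: (building_delta_inj (upart_building pp) H (delta0 n _)). Qed.

Let M_neq0 : M%:R != 0 :> F.
Proof.
rewrite pnatr_eq0 -lt0n; apply/card_gt0P; exists 0; rewrite in_set; exact: delta0.
Qed.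

Let psigma_delta0l s (j : midx N k) : delta_part (psigma p s) 0 j = delta_part (upart p) j 0%R.
Proof.
rewrite psigma_delta //; apply/existsP/idP => [[h /andP[/upart0 ->]]|H].
  by rewrite (_ : [ffun _ => _] = 0) //; apply/ffunP => a; rewrite !ffunE.
exists 0; rewrite delta0 /= (_ : [ffun _ => _] = 0) //; apply/ffunP => a; rewrite !ffunE //.
Qed.

Let psigma_delta0r s (i : midx N k) : delta_part (psigma p s) i 0 = delta_part (upart p) i 0%R.
Proof.
rewrite -delta_pinv psigmaV; exact: psigma_delta0l.
Qed.

(** The symmetry p_sigma has the same blocks inside each row as p, which fixes
    its normalisation: N to the power [nbeta] is the square of M. *)
Lemma Tmap_psigma s : Tmap F N (psigma p s) = M%:R^-1 *: Tcirc F N (psigma p s).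
Proof.
congr (_^-1 *: _); apply/eqP.
rewrite -(@eqrXn2 _ 2) ?exprn_ge0 ?sqrtC_ge0 ?ler0n // -exprM mulnC exprM sqrtCK.
rewrite -!natrX eqr_nat -card_nbeta expnS expn1; apply/eqP; congr (_ * _)%N;
  by apply: eq_card => i; rewrite !in_set ?psigma_delta0l ?psigma_delta0r.
Qed.

Let nloop_psigma s t : nloop n (psigma p s) (psigma p t) = M.
Proof.
have E (h : midx N k) : delta_part (psigma p s) 0 h && delta_part (psigma p t) h 0 =
    delta_part (upart p) h 0%R.
  exact: etrans (congr2 andb (psigma_delta0l s h) (psigma_delta0r t h)) (andbb _).
apply: eq_card => h; apply: etrans (in_set _ _) _; apply: etrans (E h) _.
by rewrite /M; symmetry; apply: etrans (in_set _ _) _.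
Qed.

Let scaled_mul m (A B C : 'M[F]_m) : A *m B = M%:R *: C ->
  (M%:R^-1 *: A) *m (M%:R^-1 *: B) = M%:R^-1 *: C.
Proof. by move=> E; rewrite -scalemxAl -scalemxAr E !scalerA (mulfVK M_neq0). Qed.

Let scaled_adj m (A B : 'M[F]_m) : A ^t* = B -> (M%:R^-1 *: A)^t* = M%:R^-1 *: B.
Proof. by move=> <-; rewrite trmxCZ fmorphV rmorph_nat. Qed.

(** The middle labellings counted in this product are those of the upper
    half of p with zero lower labels, which is exactly the number M of the
    normalisation. *)
Lemma Tmap_psigmaM s t :
  Tmap F N (psigma p t) *m Tmap F N (psigma p s) = Tmap F N (psigma p (s * t)%g).
Proof.
apply: etrans (congr2 (fun A B => A *m B) (Tmap_psigma t) (Tmap_psigma s)) _.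
apply: etrans _ (esym (Tmap_psigma _)); apply: scaled_mul.
apply: etrans (TcircM _ _) _; congr (_%:R *: Tcirc F N _); last exact: psigmaM.
exact: nloop_psigma.
Qed.

Lemma Tmap_psigmaV s : (Tmap F N (psigma p s))^t* = Tmap F N (psigma p s^-1%g).
Proof.
apply: etrans (congr1 (fun A => A ^t*) (Tmap_psigma s)) _.
apply: etrans _ (esym (Tmap_psigma _)); apply: scaled_adj.
by apply: etrans (TcircV _) _; congr (Tcirc F N _); apply: psigmaV.
Qed.

Lemma Tmap_psigma1 : Tmap F N (psigma p 1%g) = Tmap F N p.
Proof. by congr (Tmap F N _); apply: psigma1. Qed.

Lemma Tmap_proj : is_proj (Tmap F N p).
Proof.
have E := Tmap_psigma1; split.
  apply: etrans (congr2 (fun A B => A *m B) (esym E) (esym E)) _.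
  apply: etrans (Tmap_psigmaM _ _) _; apply: etrans E.
  by congr (Tmap F N (psigma p _)); apply: mulg1.
apply: etrans (congr1 (fun A => A ^t*) (esym E)) _.
apply: etrans (Tmap_psigmaV _) _; apply: etrans E.
by congr (Tmap F N (psigma p _)); apply: invg1.
Qed.
End Symmetry.

End TMaps.

(** * Group algebras and minimal projections *)

Section GroupRing.
Variables (F : numClosedFieldType) (gT : finGroupType) (G : {group gT}).
Local Notation aG := (regular_repr F G).
Local Notation nG := (gcard G).
Local Notation inB := (fun x : 'M[F]_nG => (x \in group_ring F G)%MS).

Lemma regular_adj s : s \in G -> (aG s)^t* = aG s^-1%g.
Proof.
move=> sG; apply/matrixP => i j; rewrite !mxE.
rewrite !eqxx /= -[j in RHS]gring_valK -[i in LHS]gring_valK.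
rewrite !(inj_in_eq (can_in_inj (@gring_indexK _ G))) ?groupM ?groupV ?enum_valP //.
rewrite rmorph_nat; congr (_%:R); congr (nat_of_bool _).
by apply/eqP/eqP => ->; rewrite ?mulgK ?mulgKV.
Qed.

Lemma group_ring_alg : matalg inB.
Proof.
split=> [|a x y Bx By|x y Bx By|x].
- exact: envelop_mx1.
- by rewrite linearP /= addmx_sub // scalemx_sub.
- exact: envelop_mxM.
- move=> /envelop_mxP[a ->]; rewrite trmxC_sum linear_sum summx_sub //= => s sG.
  by rewrite trmxCZ linearZ /= scalemx_sub // regular_adj // envelop_mx_id ?groupV.
Qed.

Lemma group_ring_ind (C : 'M[F]_nG -> Prop) :
  (forall a x y, C x -> C y -> C (a *: x + y)) -> C 0 ->
  (forall s, s \in G -> C (aG s)) -> forall x, inB x -> C x.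
Proof.
move=> CL C0 CG x /envelop_mxP[a ->]; apply: big_ind => // [y z Cy Cz|s sG].
  by rewrite -[y]scale1r; apply: CL.
by rewrite -[_ *: _]addr0; apply: CL => //; apply: CG.
Qed.

Let sG := DecSocleType aG.
Variables (a : sG) (e : 'M[F]_nG).
Hypothesis mine : minimal_proj a e.

Let F'G : ([pchar F]^'.-group G)%g. Proof. by apply/pgroupP=> p _; rewrite inE /= pchar_num. Qed.

Let inBW i x : (x \in Wedderburn_subring (i : sG))%MS -> inB x.
Proof. by move=> xi; rewrite /= -(Wedderburn_sum_pchar sG F'G) (sumsmx_sup i). Qed.

(** The Wedderburn component of e is an ideal, so that a subprojection of e
    in the group algebra lies in this component, where e is minimal. *)
Lemma minimal_proj_corner x : inB x -> exists c, e *m x *m e = c *: e.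
Proof.
case: mine => pe eW _ emin; apply: (min_corner group_ring_alg pe (inBW eW)).
move=> f pf fB ef; apply: emin => //; rewrite -ef.
have /andP[_ rid] := Wedderburn_ideal a.
by apply: submx_trans rid; rewrite mem_mulsmx.
Qed.

Lemma mul_delta_sandwich d (M : 'M[F]_d) (i i0 j0 j : 'I_d) :
  delta_mx i i0 *m M *m delta_mx j0 j = M i0 j0 *: delta_mx i j.
Proof.
rewrite -[delta_mx i i0](mul_delta_mx (0 : 'I_1)) -[delta_mx j0 j](mul_delta_mx (0 : 'I_1)).
rewrite !mulmxA -(mulmxA (delta_mx i 0)) -rowE -(mulmxA (delta_mx i 0)) -colE.
by rewrite [col _ _]mx11_scalar !mxE mul_mx_scalar -scalemxAl mul_delta_mx.
Qed.

(** The component is isomorphic to the algebra of matrices of size dim(a), in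
    which a nonzero matrix is moved to each of the diagonal matrix units by
    multiplication on both sides. This is the origin of the bound on the
    multiplicities. *)
Lemma minimal_proj_gen : exists g h : 'I_(irr_degree a) -> 'M[F]_nG,
  [/\ forall i, inB (g i), forall i, inB (h i) &
      \sum_i g i *m e *m h i = Wedderburn_id a].
Proof.
case: mine => pe eW e0 _; pose rho := irr_repr a.
have irr_rho : mx_irreducible rho by apply: socle_irr.
have rhoK := irr_reprK_pchar F'G a.
have injW x y : (x \in Wedderburn_subring a)%MS -> (y \in Wedderburn_subring a)%MS ->
    gring_op rho x = gring_op rho y -> x = y.
  by move=> xa ya; apply: (@regular_op_inj_pchar _ _ _ sG F'G _ _ irr_rho); rewrite inE /= rhoK.
have surj M : exists2 x, inB x & gring_op rho x = M.
  have: (M \in enveloping_algebra_mx rho)%MS.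
    apply: submx_full; rewrite /row_full.
    by have /andP[_] := @group_closure_closed_field F gT G _ _ irr_rho => /eqP ->.
  case/submxP=> c cE; exists (gring_mx aG c); first exact: gring_mxP.
  by rewrite gring_op_mx /gring_mx /= -cE mxvecK.
have [[i0 j0] /= t0] : exists ij : 'I_(irr_degree a) * 'I_(irr_degree a), gring_op rho e ij.1 ij.2 != 0.
  apply/existsP; apply: contraNT e0 => /existsPn H; apply/eqP/injW; rewrite ?linear0 ?sub0mx //.
  apply/matrixP => i j; have := H (i, j); rewrite negbK /= => /eqP Hij. by rewrite [RHS]mxE.
set t := gring_op rho e i0 j0 in t0.
have [g gB gE] := fin_all_exists2 (fun i => surj (delta_mx i i0)).
have [h hB hE] := fin_all_exists2 (fun i => surj (t^-1 *: delta_mx j0 i)).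
have E i : gring_op rho (g i *m e *m h i) = delta_mx i i.
  rewrite !gring_opM ?gE ?hE //; last exact: (inBW eW).
  by rewrite -scalemxAr mul_delta_sandwich scalerA mulVf // scale1r.
exists g, h; split=> //; have /andP[lid rid] := Wedderburn_ideal a.
apply: injW; last first.
- rewrite linear_sum (eq_bigr _ (fun i _ => E i)) op_Wedderburn_id_pchar //.
  by rewrite mx1_sum_delta.
- exact: Wedderburn_id_mem.
rewrite linear_sum summx_sub //= => i _.
apply: submx_trans rid; apply: mem_mulsmx; last exact: hB.
by apply: submx_trans lid; apply: mem_mulsmx; [exact: gB | exact: eW].
Qed.
End GroupRing.

Lemma sum_Wedderburn_id (F : numClosedFieldType) (gT : finGroupType) (G : {group gT}) :
  \sum_(a : DecSocleType (regular_repr F G)) Wedderburn_id a = 1%:M.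
Proof.
by apply: Wedderburn_sum_id_pchar; apply/pgroupP=> p _; rewrite inE /= pchar_num.
Qed.

Section AntiRepresentation.
Variables (F : numClosedFieldType) (gT : finGroupType) (G : {group gT}) (n : nat).
Variables (P : 'M[F]_n) (T : gT -> 'M[F]_n).
Hypothesis TM : forall s t, s \in G -> t \in G -> T t *m T s = T (s * t)%g.
Hypothesis TV : forall s, s \in G -> (T s)^t* = T s^-1%g.
Hypothesis pP : is_proj P.
Hypothesis PT1 : P *m T 1%g = P.
Hypothesis PTC : forall s, s \in G -> P *m T s = T s *m P.

Local Notation aG := (regular_repr F G).
Local Notation inB := (fun x : 'M[F]_(gcard G) => (x \in group_ring F G)%MS).

(** Products are reversed, since T_t T_s is T_(s * t) when s * t means first s. *)
Definition antirep (x : 'M[F]_(gcard G)) : 'M[F]_n :=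
  \sum_(s in G) gring_row x 0 (gring_index G s) *: (P *m T s *m P).

Lemma antirepL a x y : antirep (a *: x + y) = a *: antirep x + antirep y.
Proof.
rewrite /antirep scaler_sumr -big_split /=; apply: eq_bigr => s _.
by rewrite linearP !mxE scalerDl scalerA.
Qed.

Lemma antirep0 : antirep 0 = 0.
Proof. by rewrite /antirep big1 // => s _; rewrite linear0 mxE scale0r. Qed.

Lemma antirepG s : s \in G -> antirep (aG s) = P *m T s *m P.
Proof.
move=> sG; rewrite /antirep (bigD1 s) //= big1 => [|t /andP[tG ts]].
  by rewrite /gring_row rowK mxE gring_indexK // mul1g !eqxx scale1r addr0.
rewrite /gring_row rowK mxE gring_indexK // mul1g eqxx /= (inj_in_eq (can_in_inj (@gring_indexK _ G))) //.
by rewrite (negPf ts) scale0r.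
Qed.

Lemma antirepM x y : inB x -> inB y -> antirep (x *m y) = antirep y *m antirep x.
Proof.
have [PP _] := pP; move=> Bx By; move: x Bx; apply: group_ring_ind => [a x x' H H'||s sG].
- by rewrite mulmxDl -scalemxAl !antirepL mulmxDr -scalemxAr H H'.
- by rewrite mul0mx antirep0 mulmx0.
move: y By; apply: group_ring_ind => [a x x' H H'||t tG].
- by rewrite mulmxDr -scalemxAr !antirepL mulmxDl -scalemxAl H H'.
- by rewrite mulmx0 antirep0 mul0mx.
rewrite -repr_mxM // !antirepG ?groupM // -TM // !mulmxA -(mulmxA _ P P) PP.
by rewrite -(mulmxA _ P (T s)) PTC // mulmxA -(mulmxA _ P P) PP.
Qed.

Lemma antirepV x : inB x -> (antirep x)^t* = antirep (x^t*).
Proof.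
have [PP Ps] := pP; move: x; apply: group_ring_ind => [a x x' H H'||s sG].
- by rewrite antirepL !(trmxCD, trmxCZ) antirepL H H'.
- by rewrite trmxC0 antirep0 trmxC0.
by rewrite regular_adj // !antirepG ?groupV // !trmxCM Ps TV // mulmxA.
Qed.

Lemma antirep1 : antirep 1%:M = P.
Proof. by rewrite -(repr_mx1 aG) antirepG // PT1; case: pP. Qed.

Lemma antirep_proj e : inB e -> is_proj e -> is_proj (antirep e).
Proof. by move=> Be [ee es]; split; rewrite ?antirepV ?es // -antirepM ?ee. Qed.

Lemma antirep_absorb x : P *m antirep x = antirep x /\ antirep x *m P = antirep x.
Proof.
have [PP _] := pP; rewrite /antirep mulmx_sumr mulmx_suml.
by split; apply: eq_bigr => s _; rewrite -?scalemxAr -?scalemxAl ?mulmxA ?PP // -mulmxA PP.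
Qed.

End AntiRepresentation.

(** * Intertwiners and isometric embeddings *)

Section Reps.
Variables (F : numClosedFieldType) (N : nat) (G : cmqg F N).
Implicit Types v w : mrep G.
Local Notation scal := (scal_mx G).

Lemma scalM m n p (A : 'M[F]_(m, n)) (B : 'M[F]_(n, p)) :
  scal (A *m B) = scal A *m scal B.
Proof. exact: map_mxM. Qed.

Lemma scal1 n : scal (1%:M : 'M[F]_n) = 1%:M.
Proof. exact: map_mx1. Qed.

Lemma scal0 m n : scal (0 : 'M[F]_(m, n)) = 0.
Proof. exact: map_mx0. Qed.

Lemma scalD m n (A B : 'M[F]_(m, n)) : scal (A + B) = scal A + scal B.
Proof. exact: map_mxD. Qed.

Lemma scalZ m n a (A : 'M[F]_(m, n)) : scal (a *: A) = (in_alg G a) *: scal A.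
Proof. exact: map_mxZ. Qed.

Lemma mul_in_alg_mx m n p a (A : 'M[G]_(m, n)) (B : 'M[G]_(n, p)) :
  A *m (in_alg G a *: B) = in_alg G a *: (A *m B).
Proof.
apply/matrixP => i j; rewrite !mxE mulr_sumr; apply: eq_bigr => r _.
by rewrite mxE /= mulr_algl mulr_algl -scalerAr.
Qed.

Lemma HomL v w a S T : @Defs.Hom F N G v w S -> @Defs.Hom F N G v w T -> @Defs.Hom F N G v w (a *: S + T).
Proof.
rewrite /Defs.Hom => HS HT.
by rewrite !scalD mulmxDl mulmxDr HT scalZ -scalemxAl mul_in_alg_mx HS.
Qed.

Lemma HomM v w x S T : @Defs.Hom F N G v w S -> @Defs.Hom F N G w x T -> @Defs.Hom F N G v x (T *m S).
Proof. by rewrite /Defs.Hom !scalM => HS HT; rewrite -mulmxA HS !mulmxA HT. Qed.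

Lemma Hom1 v : @Defs.Hom F N G v v 1%:M.
Proof. by rewrite /Defs.Hom scal1 mul1mx mulmx1. Qed.

(** A copy of w inside v, with orthogonal projection Q. *)
Definition embeds v w (Q : 'M[F]_(rdim v)) : Prop :=
  exists S : 'M[F]_(rdim v, rdim w),
    [/\ @Defs.Hom F N G w v S, S^t* *m S = 1%:M & S *m S^t* = Q].

Lemma embeds_uequiv v w : embeds w (1%:M : 'M_(rdim v)) -> uequiv v w.
Proof.
case=> S [HS SS1 SS2]; exists (S^t*); rewrite trmxCK; split=> //.
rewrite /Defs.Hom -[LHS]mulmx1 -[in LHS]scal1 -SS2 scalM -mulmxA [rmx v *m _]mulmxA -HS !mulmxA.
by rewrite -[scal (S^t*) *m _]scalM SS1 scal1 mul1mx.
Qed.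

Lemma embeds_rep0 v : embeds (rep0 G) (0 : 'M_(rdim v)).
Proof.
exists 0; split; first by rewrite /Defs.Hom scal0 mul0mx mulmx0.
  by rewrite mulmx0; apply/matrixP => [[]].
by rewrite mul0mx.
Qed.

Lemma embeds_dsum v w1 w2 (Q1 Q2 : 'M[F]_(rdim v)) : Q1 *m Q2 = 0 ->
  embeds w1 Q1 -> embeds w2 Q2 -> embeds (dsum w1 w2) (Q1 + Q2).
Proof.
move=> Q12 [S1 [H1 S11 S12]] [S2 [H2 S21 S22]].
exists (row_mx S1 S2).
have S1S2 : S1^t* *m S2 = 0.
  rewrite -[S1^t*]mul1mx -S11 -mulmxA -[S2]mulmx1 -S21.
  rewrite !mulmxA -(mulmxA _ S1) S12 -(mulmxA _ S2) S22.
  by rewrite -(mulmxA _ Q1) Q12 mulmx0 mul0mx.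
have S2S1 : S2^t* *m S1 = 0.
  by rewrite -[_ *m _]trmxCK trmxCM trmxCK S1S2 trmxC0.
split.
- rewrite /Defs.Hom /scal_mx map_row_mx /= mul_row_block !mulmx0 addr0 add0r mul_mx_row.
  by congr row_mx.
- rewrite tr_row_mx map_col_mx mul_col_row S11 S21 S1S2 S2S1.
  by rewrite -scalar_mx_block.
- by rewrite tr_row_mx map_col_mx mul_row_col S12 S22.
Qed.

(** A partial isometry Z with source P that intertwines v with itself carries
    the subrepresentation on the range of P to the range of Z. *)
Lemma embeds_subrep v (P Z : 'M[F]_(rdim v)) : is_proj P ->
  @Defs.Hom F N G v v P -> @Defs.Hom F N G v v Z -> Z^t* *m Z = P ->
  embeds (subrep P) (Z *m Z^t*).
Proof.
move=> pP HP HZ ZZ; have := proj_onb pP; set Q := schmidt _ => -[QQ1 QQ2].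
have [PP Ps] := pP.
have ZP : Z *m P = Z.
  apply/eqP; rewrite -subr_eq0; apply/eqP/gram_eq0.
  have -> : Z *m P - Z = Z *m (P - 1%:M) by rewrite mulmxBr mulmx1.
  by rewrite trmxCM mulmxA -(mulmxA _ _ Z) ZZ -mulmxA mulmxBr PP mulmx1 subrr mulmx0.
have QP : Q *m P = Q.
  by have : Q *m (Q^t* *m Q) = Q; [rewrite mulmxA QQ1 mul1mx | rewrite QQ2].
have PQ : P *m Q^t* = Q^t* by have := congr1 (fun B => B^t*) QP; rewrite trmxCM Ps.
exists (Z *m Q^t*); split.
- rewrite /Defs.Hom /subrep /= -/Q.
  rewrite scalM !mulmxA -(mulmxA (scal Z)) -scalM QQ2 -scalM ZP.
  by rewrite HZ -mulmxA -scalM.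
- by rewrite trmxCM trmxCK mulmxA -(mulmxA Q) ZZ QP QQ1.
- by rewrite trmxCM trmxCK mulmxA -(mulmxA Z) QQ2 ZP.
Qed.

End Reps.

(** * Gram-Schmidt decomposition of a representation *)

Section Greedy.
Variables (F : numClosedFieldType) (N : nat) (G : cmqg F N) (v : mrep G).
Local Notation A := (@Defs.Hom F N G v v).
Hypothesis algA : matalg A.

(** The state of the Gram-Schmidt process: a copy of w has been placed on the
    range of Q', orthogonally to the range of Q, and together these ranges
    contain those of the elements of Xs. *)
Definition fills (Q Q' : 'M[F]_(rdim v)) (w : mrep G) (Xs : 'M[F]_(rdim v) -> Prop) :=
  [/\ A Q', is_proj Q', Q *m Q' = 0, embeds w Q' & forall X, Xs X -> (Q + Q') *m X = X].

Lemma proj_add (Q Q' : 'M[F]_(rdim v)) : is_proj Q -> is_proj Q' -> Q *m Q' = 0 -> is_proj (Q + Q').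
Proof.
move=> [QQ Qs] [QQ' Qs'] O; have O' : Q' *m Q = 0.
  by rewrite -[LHS]trmxCK trmxCM Qs Qs' O trmxC0.
by split; [rewrite mulmxDl !mulmxDr QQ QQ' O O' addr0 add0r | rewrite trmxCD Qs Qs'].
Qed.

Lemma proj_orth_sym (Q Q' : 'M[F]_(rdim v)) : is_proj Q -> is_proj Q' -> Q *m Q' = 0 -> Q' *m Q = 0.
Proof. by move=> [_ Qs] [_ Qs'] O; rewrite -[LHS]trmxCK trmxCM Qs Qs' O trmxC0. Qed.

Lemma fills0 (Q : 'M[F]_(rdim v)) (Xs : 'M[F]_(rdim v) -> Prop) :
  (forall X, Xs X -> Q *m X = X) -> fills Q 0 (rep0 G) Xs.
Proof.
move=> H; split; first exact: matalg0.
- by split; rewrite ?mulmx0 ?trmxC0.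
- by rewrite mulmx0.
- exact: embeds_rep0.
- by move=> X /H; rewrite addr0.
Qed.

Lemma fills_dsum (Q Q1 Q2 : 'M[F]_(rdim v)) w1 w2 Xs1 Xs2 : is_proj Q ->
  fills Q Q1 w1 Xs1 -> fills (Q + Q1) Q2 w2 Xs2 ->
  fills Q (Q1 + Q2) (dsum w1 w2) (fun X => Xs1 X \/ Xs2 X).
Proof.
move=> pQ [A1 p1 O1 E1 H1] [A2 p2 O2 E2 H2].
have Q2Q := proj_orth_sym (proj_add pQ p1 O1) p2 O2.
have [QQ _] := pQ; have [Q11 _] := p1.
have Q12 : Q1 *m Q2 = 0.
  transitivity (Q1 *m ((Q + Q1) *m Q2)); last by rewrite O2 mulmx0.
  by rewrite mulmxA mulmxDr (proj_orth_sym pQ p1 O1) add0r Q11.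
have QQ2 : Q *m Q2 = 0.
  transitivity (Q *m ((Q + Q1) *m Q2)); last by rewrite O2 mulmx0.
  by rewrite mulmxA mulmxDr QQ O1 addr0.
split.
- exact: matalgD.
- exact: proj_add.
- by rewrite mulmxDr O1 QQ2 addr0.
- exact: embeds_dsum.
move=> X [/H1 | /H2] HX; last by rewrite addrA.
by rewrite addrA mulmxDl HX -[X in Q2 *m X]HX mulmxA Q2Q mul0mx addr0.
Qed.

(** Each X lies already in the range reached so far or contributes one new
    copy of the range of E. *)
Lemma fills_dmult (E Q : 'M[F]_(rdim v)) (Xs : seq 'M[F]_(rdim v)) :
  is_proj E -> A E -> (forall x, A x -> exists c, E *m x *m E = c *: E) ->
  is_proj Q -> A Q -> (forall X, X \in Xs -> A X /\ X *m E = X) ->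
  exists2 m, (m <= size Xs)%N & exists Q', fills Q Q' (dmult m (subrep E)) (fun X => X \in Xs).
Proof.
move=> pE AE corner; elim: Xs Q => [|X Xs IH] Q pQ AQ HXs.
  by exists 0%N => //; exists 0; apply: fills0.
have [AX XE] := HXs X (mem_head _ _).
have HXs' Y : Y \in Xs -> A Y /\ Y *m E = Y by move=> H; apply: HXs; rewrite inE H orbT.
have [QX|[Z [AZ ZZ QZ ZX]]] := greedy_step algA pQ AQ pE AX XE corner.
  have [m le_m [Q' [A' p' O' E' H']]] := IH Q pQ AQ HXs'.
  exists m; first exact: leqW; exists Q'; split=> // Y.
  rewrite inE => /orP[/eqP->|]; last exact: H'.
  by rewrite mulmxDl QX -[X in Q' *m X]QX mulmxA (proj_orth_sym pQ p' O') mul0mx addr0.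
have [EE _] := pE.
have AP : A (Z *m Z^t*) by apply: (matalgM algA) => //; apply: (matalgV algA).
have pP : is_proj (Z *m Z^t*).
  split; last by rewrite trmxCM trmxCK.
  rewrite mulmxA -(mulmxA Z) ZZ; congr (_ *m _).
  apply/eqP; rewrite -subr_eq0; apply/eqP/gram_eq0.
  have -> : Z *m E - Z = Z *m (E - 1%:M) by rewrite mulmxBr mulmx1.
  by rewrite trmxCM mulmxA -(mulmxA _ _ Z) ZZ -mulmxA mulmxBr EE mulmx1 subrr mulmx0.
have QP : Q *m (Z *m Z^t*) = 0 by rewrite mulmxA QZ mul0mx.
have [m le_m [Q' H']] := IH (Q + Z *m Z^t*) (proj_add pQ pP QP) (matalgD algA AQ AP) HXs'.
exists m.+1 => //; exists (Z *m Z^t* + Q').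
have H1 : fills Q (Z *m Z^t*) (subrep E) (fun Y => Y = X).
  by split=> //; [apply: embeds_subrep | move=> _ ->].
have [? ? ? ? H2] := fills_dsum pQ H1 H'; split=> // Y.
by rewrite inE => /orP[/eqP|] H; apply: H2; [left|right].
Qed.

(** The multiplicity chosen at an index depends on the projection reached
    before it, hence the choice function is updated along the enumeration. *)
Lemma fills_big (I : eqType) (C : I -> Type) (W : forall i, C i -> mrep G)
    (ok : forall i, C i -> Prop) (Xs : I -> 'M[F]_(rdim v) -> Prop)
    (c0 : forall i, C i) (r : seq I) :
  uniq r ->
  (forall i Q, i \in r -> is_proj Q -> A Q ->
     exists2 c : C i, ok i c & exists Q', fills Q Q' (W i c) (Xs i)) ->
  forall Q, is_proj Q -> A Q ->
  exists2 c : forall i, C i, (forall i, i \in r -> ok i (c i)) &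
    exists Q', fills Q Q' (\big[@dsum F N G/rep0 G]_(i <- r) W i (c i))
      (fun X => exists2 i, i \in r & Xs i X).
Proof.
elim: r => [|i r IH] /=.
  move=> _ _ Q pQ AQ; exists c0 => //; exists 0; rewrite big_nil; apply: fills0.
  by move=> X [].
move=> /andP[ir ur] H Q pQ AQ.
have [ci oki [Q1 H1]] := H i Q (mem_head _ _) pQ AQ.
have [A1 p1 O1 _ _] := H1.
have [|c okc [Q2 H2]] := IH ur _ (Q + Q1) (proj_add pQ p1 O1) (matalgD algA AQ A1).
  by move=> j Q' jr; apply: H; rewrite inE jr orbT.
have cj j : j \in r -> dfwith c ci j = c j.
  by move=> jr; apply: dfwith_out; apply: contraNneq ir => ->.
exists (dfwith c ci) => [j|].
  rewrite inE => /orP[/eqP->|jr]; first by rewrite dfwith_in.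
  by rewrite cj //; apply: okc.
exists (Q1 + Q2); rewrite big_cons dfwith_in.
rewrite (eq_big_seq _ (fun j jr => congr1 (W j) (cj j jr))).
have [? ? ? ? H3] := fills_dsum pQ H1 H2; split=> // X [j].
by rewrite inE => /orP[/eqP->|jr] HX; apply: H3; [left|right; exists j].
Qed.

End Greedy.

(** * The projections P_p and their corners *)

Lemma scale_absorb (F : fieldType) n m (P : 'M[F]_n) (X : 'M[F]_(n, m)) c :
  P *m P = P -> c != 0 -> P *m X = c *: X -> P *m X = X.
Proof.
move=> PP c0 E; have H : c *: X = c *: (P *m X).
  by rewrite -{1}E -{1}PP -mulmxA {1}E -scalemxAr.
by rewrite -[RHS](scalerK c0) H scalerK.
Qed.

Lemma corner_scale (F : fieldType) n (P Tp Tr X Y : 'M[F]_n) c d f :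
  P *m Tp = P -> Tp *m P = P -> Tr *m Tp = d *: X -> Tp *m X = f *: Y ->
  P *m (c *: Tr) *m P = (c * d * f) *: (P *m Y *m P).
Proof.
move=> PT TP E1 E2; rewrite -scalemxAr -scalemxAl.
have -> : P *m Tr *m P = P *m (Tp *m (Tr *m Tp)) *m P.
  by rewrite !mulmxA PT -[RHS]mulmxA TP.
by rewrite E1 -scalemxAr E2 -!scalemxAr -!scalemxAl !scalerA.
Qed.

Lemma corner_mul (F : fieldType) n (P E x y : 'M[F]_n) c :
  P *m E = E -> E *m P = E -> P *m x *m P = y -> E *m (y *m E) = c *: E ->
  E *m x *m E = c *: E.
Proof. by move=> PE EP <- <-; rewrite !mulmxA EP -!mulmxA PE. Qed.

Section Easy.
Variables (F : numClosedFieldType) (n : nat).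
Local Notation N := n.+1.
Variables (G : cmqg F N) (K : category).
Hypothesis hG : easy G K.

Lemma Hom_Tmap k l (p : part k l) : p \in K k l ->
  @Hom F N G (tpow G k) (tpow G l) (Tmap F N p).
Proof.
move=> pK; case: hG => _ /(_ k l (Tmap F N p)) [_]; apply.
exists (fun q => (q == p)%:R); rewrite (bigD1 p) //= eqxx scale1r big1 ?addr0 // => q.
by case/andP=> _ /negPf->; rewrite scale0r.
Qed.

Section Level.
Variable k : nat.
Local Notation V := (tpow G k).
Local Notation A := (@Hom F N G V V).
Local Notation T := (@Tmap F N k k).

Lemma tpow_alg : matalg A.
Proof.
have AL := @HomL F N G V V; have A0 : A 0.
  by rewrite /Defs.Hom scal0 mul0mx mulmx0.
split=> [|a x y|x y Ax Ay|x Ax].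
- exact: Hom1.
- exact: AL.
- exact: HomM Ay Ax.
case: hG => _ /(_ k k x) [/(_ Ax) [c ->] _]; rewrite trmxC_sum.
apply: (big_ind A) => // [y z Ay Az|p pK]; first by rewrite -[y]scale1r; apply: (AL).
rewrite trmxCZ -[_ *: _]addr0; apply: (AL) => //.
have [d _ ->] := TmapV F n p; rewrite -[_ *: _]addr0; apply: (AL) => //.
by apply: Hom_Tmap; apply: cat_inv.
Qed.

Let algA := tpow_alg.

(** The scalar c with T_p T_q = c T_q is idempotent because T_p is; being
    nonzero, it is 1. *)
Lemma Tmap_absorb p (q : part k k) : projective p -> pcomp p q = q -> T p *m T q = T q.
Proof.
move=> pp pq; have [TT _] := Tmap_proj F n pp; have [c c0 E] := TmapM F n q p.
by apply: (scale_absorb TT c0); rewrite E; congr (_ *: T _).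
Qed.

Lemma Proj_is_proj p : p \in Proj K k -> is_proj (T p).
Proof. by case/ProjP => _ pp; apply: Tmap_proj. Qed.

Lemma Proj_Hom p : p \in Proj K k -> A (T p).
Proof. by case/ProjP => pK _; apply: Hom_Tmap. Qed.

(** The supremum of the T_q with q strictly below p is the range projection of
    their sum. *)
Definition below_sum (p : part k k) : 'M[F]_(rdim V) :=
  \sum_(q in Proj K k | prec q p) T q.

(** If f is the range projection of the sum H then
    (1 - f) H (1 - f) = 0 is a sum of the positive matrices
    (1 - f) T_q (1 - f), so that f dominates each T_q; a projection dominating
    every T_q fixes H, hence f. *)
Lemma below_sum_proj p : exists s, [/\ A s, is_sup K p (below_sum p *m s) &
  forall q, q \in Proj K k -> prec q p -> below_sum p *m s *m T q = T q].
Proof.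
set H := below_sum p.
have Hs : H^t* = H.
  by rewrite trmxC_sum; apply: eq_bigr => q /andP[/Proj_is_proj[]].
have AH : A H by apply: (matalg_sum algA) => q /andP[/Proj_Hom].
have [s [As pf Hf]] := range_proj algA AH Hs; have [ff fs] := pf.
have dom q : q \in Proj K k -> prec q p -> H *m s *m T q = T q.
  move=> qK qp; pose f := H *m s; pose Y r := T r *m (1%:M - f).
  have Y0 : Y q = 0.
    apply: (@gram_sum_eq0 _ _ _ _ (fun r => (r \in Proj K k) && prec r p) Y); last by rewrite qK.
    rewrite (eq_bigr (fun r => (1%:M - f) *m T r *m (1%:M - f))).
      rewrite -mulmx_suml -mulmx_sumr -/(below_sum p) -/H.
      by rewrite -mulmxA mulmxBr mulmx1 Hf subrr mulmx0.
    move=> r /andP[/Proj_is_proj[rr rs] _].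
    by rewrite /Y trmxCM trmxCB trmxC1 fs rs mulmxA -(mulmxA _ (T r) (T r)) rr.
  have [_ qs] := Proj_is_proj qK; move/(congr1 (fun X => X^t*)): Y0.
  rewrite /Y trmxCM trmxCB trmxC1 fs qs trmxC0 mulmxBl mul1mx => /eqP.
  by rewrite subr_eq0 eq_sym => /eqP.
exists s; split=> //; split=> //; first exact: (matalgM algA).
move=> Q pQ AQ domQ; rewrite mulmxA; congr (_ *m _).
by rewrite mulmx_sumr; apply: eq_bigr => q /andP[qK qp]; apply: domQ.
Qed.

Lemma Rp_sup (p : part k k) : is_sup K p (Rp G K p).
Proof.
have [s [_ sup _]] := below_sum_proj p; rewrite /Rp.
exact: (classical_sets.xgetPex 0 (ex_intro _ _ sup)).
Qed.

(** Two suprema dominate each other, hence are equal, and this form shows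
    that the range of Rp is spanned by those of the T_q. *)
Lemma Rp_below_sum (p : part k k) : exists2 s, A s & Rp G K p = below_sum p *m s.
Proof.
have [s [As [pf Af domf supf] _]] := below_sum_proj p; exists s => //.
have [pR AR domR supR] := Rp_sup p.
have [_ Rs] := pR; have [_ fs] := pf.
have E1 := supf _ pR AR domR; have E2 := supR _ pf Af domf.
by rewrite -Rs -E2 trmxCM Rs fs E1.
Qed.

Section FixP.
Variable p : part k k.
Hypothesis pK : p \in Proj K k.
Let pp : projective p. Proof. by case/ProjP: pK. Qed.
Local Notation P := (Pp G K p).
Local Notation R := (Rp G K p).

Let pT := Proj_is_proj pK.
Let AT := Proj_Hom pK.

Lemma Tmap_Rp : T p *m R = R.
Proof.
have [_ _ _ supR] := Rp_sup p; apply: supR => // q qK /andP[/eqP pq _].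
exact: Tmap_absorb.
Qed.

Lemma Rp_Tmap : R *m T p = R.
Proof.
have [[_ Rs] _ _ _] := Rp_sup p; have [_ Ts] := pT.
by have := congr1 (fun X => X^t*) Tmap_Rp; rewrite trmxCM Rs Ts.
Qed.

Lemma Pp_Hom : A P.
Proof. by apply: (matalgB algA AT); case: (Rp_sup p). Qed.

Lemma Pp_proj : is_proj P.
Proof.
have [[RR Rs] _ _ _] := Rp_sup p; have [TT Ts] := pT.
split; last by rewrite trmxCB Rs Ts.
by rewrite mulmxBl !mulmxBr TT Tmap_Rp Rp_Tmap RR subrr subr0.
Qed.

Lemma Pp_Tmap : P *m T p = P.
Proof. by have [TT Ts] := pT; rewrite mulmxBl TT Rp_Tmap. Qed.

Lemma Tmap_Pp : T p *m P = P.
Proof. by have [TT Ts] := pT; rewrite mulmxBr TT Tmap_Rp. Qed.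

Lemma Pp_kill q : q \in Proj K k -> prec q p -> P *m T q = 0.
Proof.
move=> qK qp; have [_ _ dom _] := Rp_sup p; rewrite mulmxBl dom //.
case/andP: qp => /eqP pq _; rewrite Tmap_absorb //; exact: subrr.
Qed.

Definition Tsym s := T (psigma p s).

(** A symmetry of p permutes the projective partitions strictly below p. *)
Lemma Tsym_Rp s : s \in Sym K p -> R *m Tsym s *m R = Tsym s *m R.
Proof.
move=> sK; have [_ _ dom _] := Rp_sup p; have [t At RE] := Rp_below_sum p.
rewrite {2 3}RE !mulmxA; congr (_ *m _); rewrite !mulmx_sumr.
apply: eq_bigr => q /andP[qK qp].
have [q' q'K [q'p E]] := prec_conj pK qK qp sK.
have [c c0 ME] := TmapM F n q (psigma p s).
have q'pp : projective q' by case/ProjP: q'K.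
have HT : T q' *m T (pcomp (psigma p s) q) = T (pcomp (psigma p s) q) by apply: Tmap_absorb.
have M2 : Tsym s *m T q = c *: T (pcomp (psigma p s) q) by apply: ME.
rewrite -mulmxA M2 -scalemxAr -HT mulmxA; congr (_ *: (_ *m _)).
exact: dom.
Qed.

Lemma Tsym_Pp s : s \in Sym K p -> P *m Tsym s = Tsym s *m P.
Proof.
move=> sK; have sVK : s^-1%g \in Sym K p by rewrite groupV.
have [[_ Rs] _ _ _] := Rp_sup p.
have RT : R *m Tsym s = Tsym s *m R.
  rewrite -(Tsym_Rp sK); have := congr1 (fun X => X^t*) (Tsym_Rp sVK).
  have -> : Tsym s = (Tsym s^-1%g)^t*.
    by apply: esym; apply: etrans (Tmap_psigmaV F n pp _) _; rewrite invgK.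
  by rewrite !trmxCM Rs !mulmxA.
have TT1 : T p *m Tsym s = Tsym s.
  by apply: Tmap_absorb => //; apply: pcomp_psigma.
have TT2 : Tsym s *m T p = Tsym s.
  have E := Tmap_psigma1 F n pp.
  apply: etrans (congr1 (fun X => Tsym s *m X) (esym E)) _.
  by apply: etrans (Tmap_psigmaM F n pp _ _) _; rewrite mul1g.
by rewrite mulmxBl mulmxBr TT1 TT2 RT.
Qed.

Lemma TsymM s t : s \in Sym K p -> t \in Sym K p -> Tsym t *m Tsym s = Tsym (s * t)%g.
Proof. by move=> _ _; apply: Tmap_psigmaM. Qed.

Lemma TsymV s : s \in Sym K p -> (Tsym s)^t* = Tsym s^-1%g.
Proof. by move=> _; apply: Tmap_psigmaV. Qed.

Lemma Pp_Tsym1 : P *m Tsym 1%g = P.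
Proof.
apply: etrans (congr1 (fun X => P *m X) (Tmap_psigma1 F n pp)) _; exact: Pp_Tmap.
Qed.

Local Notation inB := (fun x : gralg F K p => (x \in group_ring F (Sym K p))%MS).
Local Notation psi := (@Psi F N G K k p).

Lemma PsiL a x y : psi (a *: x + y) = a *: psi x + psi y.
Proof. exact: antirepL. Qed.

Lemma Psi0 : psi 0 = 0.
Proof. exact: antirep0. Qed.

Lemma PsiZ a x : psi (a *: x) = a *: psi x.
Proof. by rewrite -[a *: x]addr0 PsiL Psi0 addr0. Qed.

Lemma PsiG s : s \in Sym K p -> psi (regular_repr F (Sym K p) s) = P *m Tsym s *m P.
Proof. exact: antirepG. Qed.

Lemma Psi_sum I r (Q : pred I) f : psi (\sum_(i <- r | Q i) f i) = \sum_(i <- r | Q i) psi (f i).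
Proof.
apply: (big_morph psi); last exact: antirep0.
by move=> x y; rewrite -[x]scale1r PsiL !scale1r.
Qed.

Lemma PsiM x y : inB x -> inB y -> psi (x *m y) = psi y *m psi x.
Proof. exact: (antirepM TsymM Pp_proj Tsym_Pp). Qed.

Lemma Psi_proj x : inB x -> is_proj x -> is_proj (psi x).
Proof. exact: (antirep_proj TsymM TsymV Pp_proj Tsym_Pp). Qed.

Lemma Psi1 : psi 1%:M = P.
Proof. exact: (antirep1 _ Pp_proj Pp_Tsym1). Qed.

Lemma Psi_absorb x : P *m psi x = psi x /\ psi x *m P = psi x.
Proof. exact: (antirep_absorb _ Pp_proj). Qed.

Lemma Psi_Hom x : A (psi x).
Proof.
apply: (matalg_sum algA) => s sK; apply: (matalgZ algA).
apply: (matalgM algA); last exact: Pp_Hom.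
apply: (matalgM algA); first exact: Pp_Hom.
by apply: Hom_Tmap; apply/(SymP pK).
Qed.

(** The two cases of [corner_cases] give an element of the group of
    symmetries and zero. *)
Lemma corner_Psi x : A x -> exists2 y, inB y & P *m x *m P = psi y.
Proof.
have algB := group_ring_alg F (Sym K p).
case: hG => _ /(_ k k x) [+ _] => /[apply] -[c ->].
rewrite mulmx_sumr mulmx_suml.
apply: (big_ind (fun X => exists2 y, inB y & X = psi y)) => [|X Y [y By ->] [z Bz ->]|r rK].
- by exists 0; [exact: (matalg0 algB) | rewrite Psi0].
- exists (y + z); first exact: (matalgD algB).
  by rewrite -[y in RHS]scale1r PsiL scale1r.
have [d d0 E1] := TmapM F n p r; have [f f0 E2] := TmapM F n (pcomp r p) p.
have E : P *m (c r *: T r) *m P = (c r * d * f) *: (P *m T (pcomp p (pcomp r p)) *m P).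
  exact: (corner_scale _ Pp_Tmap Tmap_Pp E1 E2).
rewrite E; case: (corner_cases pK rK) => [[s sK ->]|[q qK [qp qr]]].
  exists ((c r * d * f) *: regular_repr F (Sym K p) s).
    by apply: (matalgZ algB); apply: envelop_mx_id.
  by apply: etrans _ (esym (PsiZ _ _)); congr (_ *: _); apply: esym (PsiG sK).
exists 0; first exact: (matalg0 algB).
have qq : projective q by case/ProjP: qK.
have PT0 : P *m T (pcomp p (pcomp r p)) = 0.
  apply: etrans (congr1 (fun X => P *m X) (esym (Tmap_absorb qq qr))) _.
  by rewrite mulmxA; apply: etrans (congr1 (fun X => X *m _) (Pp_kill qK qp)) (mul0mx _ _).
by rewrite PT0 mul0mx scaler0 Psi0.
Qed.

Section Minimal.
Variables (a : Irr F K p) (e : gralg F K p).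
Hypothesis mine : minimal_proj a e.

Lemma minimal_in_ring : inB e.
Proof.
case: mine => _ eW _ _; apply: submx_trans eW _.
by rewrite genmxE submxMl.
Qed.

Let Be := minimal_in_ring.
Local Notation E := (psi e).

Lemma Psi_minimal_proj : is_proj E.
Proof. by apply: Psi_proj => //; case: mine. Qed.

(** Through Psi, this is the corresponding property of e in the group algebra. *)
Lemma Psi_minimal_corner x : A x -> exists c, E *m x *m E = c *: E.
Proof.
move=> Ax; have [y By Ey] := corner_Psi Ax.
have [c Ec] := minimal_proj_corner mine By; exists c.
have [PE EP] := Psi_absorb e.
have algB := group_ring_alg F (Sym K p).
apply: (corner_mul PE EP Ey); rewrite -(PsiM Be By) -(PsiM (matalgM algB Be By) Be) Ec.
exact: PsiZ.
Qed.

Lemma Psi_minimal_gen : exists X Y : 'I_(irr_degree a) -> 'M[F]_(rdim V),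
  [/\ forall i, A (X i), forall i, X i *m E = X i &
      psi (Wedderburn_id a) = \sum_i X i *m Y i].
Proof.
have algB := group_ring_alg F (Sym K p).
have [g [h [gB hB <-]]] := minimal_proj_gen mine; have [EE _] := Psi_minimal_proj.
exists (fun i => psi (h i) *m E), (fun i => psi (g i)); split=> [i|i|].
- by apply: (matalgM algA); apply: Psi_Hom.
- by rewrite -mulmxA EE.
rewrite Psi_sum; apply: eq_bigr => i _.
by rewrite (PsiM (matalgM algB (gB i) Be) (hB i)) (PsiM (gB i) Be) mulmxA.
Qed.

End Minimal.
Lemma Pp_sum_Psi : P = \sum_(a : Irr F K p) psi (Wedderburn_id a).
Proof. by rewrite -Psi_sum sum_Wedderburn_id Psi1. Qed.

End FixP.

(** Along the order, M vanishes on the range of every T_p, which for the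
    identity partition is the whole space. *)
Lemma Pp_total m (M : 'M[F]_(m, rdim V)) :
  (forall p, p \in Proj K k -> M *m Pp G K p = 0) -> M = 0.
Proof.
move=> H; have HT : forall p, p \in Proj K k -> M *m T p = 0.
  apply: Proj_ind => p pK IH; rewrite -[T p](subrK (Rp G K p)) mulmxDr H // add0r.
  have [s _ ->] := Rp_below_sum p; rewrite mulmxA mulmx_sumr big1 ?mul0mx //.
  by move=> q /andP[qK qp]; apply: IH.
have := HT _ (rperm1_Proj K k); rewrite /Tmap Tcirc1 -scalemxAr mulmx1.
move=> E; rewrite -[M](scalerK (nbeta_scale F n (rperm 1%g : part k k))).
by apply: etrans (congr1 (fun X => _ *: X) E) (scaler0 _ _).
Qed.

End Level.
End Easy.

(** * Decomposition of the tensor powers *)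

Section Decomposition.
Variables (F : numClosedFieldType) (n : nat).
Local Notation N := n.+1.
Variables (G : cmqg F N) (K : category).
Hypothesis hG : easy G K.
Variable k : nat.
Variable e : forall p : part k k, Irr F K p -> gralg F K p.
Hypothesis he : forall (p : part k k) (a : Irr F K p), p \in Proj K k -> minimal_proj a (@e p a).
Local Notation V := (tpow G k).
Local Notation A := (@Hom F N G V V).
Let algA := tpow_alg hG k.

(** The matrices X of [Psi_minimal_gen] are dim(a) in number, and absorbing
    them absorbs the component of the unit attached to a. *)
Lemma fills_u_p_alpha p (a : Irr F K p) (Q : 'M[F]_(rdim V)) : p \in Proj K k -> is_proj Q -> A Q ->
  exists2 m, (m <= irr_degree a)%N &
    exists Q', fills Q Q' (dmult m (u_p_alpha G (e a))) (fun X => X = Psi G (Wedderburn_id a)).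
Proof.
move=> pK pQ AQ; have mine := he a pK.
have [X [Y [AX XE ->]]] := Psi_minimal_gen hG pK mine.
pose Xs := [seq X i | i <- enum 'I_(irr_degree a)].
have XsP Z : Z \in Xs -> A Z /\ Z *m Psi G (e a) = Z.
  by case/mapP => i _ ->.
have [m le_m [Q' [A' p' O' E' H']]] := fills_dmult algA (Psi_minimal_proj hG pK mine)
   (Psi_Hom hG pK (e a)) (Psi_minimal_corner hG pK mine) pQ AQ XsP.
exists m; first by rewrite size_map size_enum_ord in le_m.
exists Q'; split=> // _ ->; rewrite mulmx_sumr; apply: eq_bigr => i _.
by rewrite mulmxA H' //; apply/mapP; exists i; rewrite ?mem_enum.
Qed.

Lemma fills_Pp p (Q : 'M[F]_(rdim V)) : p \in Proj K k -> is_proj Q -> A Q ->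
  exists2 m : Irr F K p -> nat, (forall a, m a <= irr_degree a)%N &
    exists Q', fills Q Q' (\big[@dsum F N G/rep0 G]_(a : Irr F K p) dmult (m a) (u_p_alpha G (e a)))
      (fun X => X = Pp G K p).
Proof.
move=> pK pQ AQ.
have [c okc [Q' [A' p' O' E' H']]] := @fills_big F N G V algA (Irr F K p) (fun _ => nat)
  (fun a m => dmult m (u_p_alpha G (e a))) (fun a m => (m <= irr_degree a)%N)
  (fun a X => X = Psi G (Wedderburn_id a)) (fun _ => 0%N) (index_enum (Irr F K p))
  (index_enum_uniq _) (fun a Q _ pQ AQ => fills_u_p_alpha a pK pQ AQ) Q pQ AQ.
exists c => [a|]; first by apply: okc; apply: mem_index_enum.
exists Q'; split=> // _ ->; rewrite (Pp_sum_Psi hG pK) mulmx_sumr.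
by apply: eq_bigr => a _; apply: H'; exists a; rewrite ?mem_index_enum.
Qed.

Lemma tpow_decomposition : exists nu : forall p : part k k, Irr F K p -> nat,
     (forall (p : part k k) (a : Irr F K p),
        p \in Proj K k -> (nu p a <= irr_degree a)%N) /\
     uequiv V
       (\big[@dsum F N G/rep0 G]_(p in Proj K k)
          \big[@dsum F N G/rep0 G]_(a : Irr F K p)
             dmult (nu p a) (u_p_alpha G (e a))).
Proof.
have p0 : is_proj (0 : 'M[F]_(rdim V)) by split; rewrite ?mulmx0 ?trmxC0.
pose r := [seq p <- index_enum (part k k) | p \in Proj K k].
have rP p : p \in r -> p \in Proj K k by rewrite mem_filter => /andP[].
have [c okc [Q' [A' p' O' E' H']]] := @fills_big F N G V algA (part k k) (fun p => Irr F K p -> nat)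
  (fun p m => \big[@dsum F N G/rep0 G]_(a : Irr F K p) dmult (m a) (u_p_alpha G (e a)))
  (fun p m => forall a, (m a <= irr_degree a)%N)
  (fun p X => X = Pp G K p) (fun _ _ => 0%N) r (filter_uniq _ (index_enum_uniq _))
  (fun p Q pr pQ AQ => fills_Pp (rP p pr) pQ AQ) 0 p0 (matalg0 algA).
exists c; split=> [p a pK|]; first by apply: okc; rewrite mem_filter pK mem_index_enum.
apply: embeds_uequiv; rewrite -big_filter -/r.
suff <- : Q' = 1%:M by [].
apply/eqP; rewrite -subr_eq0; apply/eqP; apply: (Pp_total hG) => p pK.
have := H' (Pp G K p); rewrite add0r mulmxBl mul1mx => ->; first exact: subrr.
by exists p; rewrite // mem_filter pK mem_index_enum.
Qed.

End Decomposition.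

(** * Coefficients and intertwiners *)

Lemma star1 (F : numClosedFieldType) (B : star_algebra F) : star (1 : B) = 1.
Proof. by rewrite -[RHS](starK (1 : B)) -[star (1 : B) in RHS]mul1r starM starK mul1r. Qed.

Lemma star0 (F : numClosedFieldType) (B : star_algebra F) : star (0 : B) = 0.
Proof. by apply: (addrI (star (0 : B))); rewrite -starD !addr0. Qed.

Lemma star_sum (F : numClosedFieldType) (B : star_algebra F) I r (P : pred I) (f : I -> B) :
  star (\sum_(i <- r | P i) f i) = \sum_(i <- r | P i) star (f i).
Proof. exact: (big_morph _ (@starD _ B) (star0 B)). Qed.

Section Coefficients.
Variables (F : numClosedFieldType) (N : nat) (G : cmqg F N).
Implicit Types v w : mrep G.

(** The elementary tensor of x and y. *)
Definition ten (x y : G) := tleft (square_of G) x * tright (square_of G) y.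

(** This rewrites a tensor along a chosen family b of left factors. *)
Lemma ten_suml (I J : finType) (al : J -> I -> F) (b : J -> G) (y : I -> G) :
  \sum_i ten (\sum_j al j i *: b j) (y i) = \sum_j ten (b j) (\sum_i al j i *: y i).
Proof.
under eq_bigr => i _ do rewrite /ten linear_sum mulr_suml.
rewrite exchange_big; apply: eq_bigr => j _ /=.
rewrite /ten linear_sum mulr_sumr; apply: eq_bigr => i _.
by rewrite !linearZ /= -scalerAl -scalerAr.
Qed.

Lemma ten_sumr (I J : finType) (al : J -> I -> F) (b : J -> G) (y : I -> G) :
  \sum_i ten (y i) (\sum_j al j i *: b j) = \sum_j ten (\sum_i al j i *: y i) (b j).
Proof. by rewrite [RHS]ten_suml. Qed.

Definition comatrix v := forall i j,
  comult G (v i j) = \sum_r ten (v i r) (v r j).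

Definition mcoef w (a : 'M[F]_(rdim w)) : G := \sum_k \sum_l a k l *: w k l.
Arguments mcoef w a : clear implicits.

Lemma mcoefL w c (a a' : 'M[F]_(rdim w)) : mcoef w (c *: a + a') = c *: mcoef w a + mcoef w a'.
Proof.
rewrite /mcoef scaler_sumr -big_split; apply: eq_bigr => k _.
rewrite /= scaler_sumr -big_split; apply: eq_bigr => l _.
by rewrite !mxE scalerDl scalerA.
Qed.

Lemma mcoef0 w : mcoef w (0 : 'M[F]_(rdim w)) = 0.
Proof. by rewrite /mcoef big1 // => k _; rewrite big1 // => l _; rewrite mxE scale0r. Qed.

Lemma mcoefD w (a a' : 'M[F]_(rdim w)) : mcoef w (a + a') = mcoef w a + mcoef w a'.
Proof. by rewrite -[a]scale1r mcoefL !scale1r. Qed.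

Lemma mcoefZ w c (a : 'M[F]_(rdim w)) : mcoef w (c *: a) = c *: mcoef w a.
Proof. by rewrite -[c *: a]addr0 mcoefL mcoef0 addr0. Qed.

Lemma mcoef_sum w (I : finType) (f : I -> 'M[F]_(rdim w)) : mcoef w (\sum_i f i) = \sum_i mcoef w (f i).
Proof. exact: (big_morph _ (@mcoefD w) (@mcoef0 w)). Qed.

Lemma mcoef_delta w k l : mcoef w (delta_mx k l : 'M[F]_(rdim w)) = w k l.
Proof.
rewrite /mcoef (bigD1 k) //= (bigD1 l) //= mxE !eqxx scale1r big1 => [|j jl]; last first.
  by rewrite mxE eqxx (negPf jl) scale0r.
rewrite big1 ?addr0 // => i ik; rewrite big1 // => j _.
by rewrite mxE (negPf ik) scale0r.
Qed.

Lemma trace_mxvec m (y x : 'M[F]_m) :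
  \tr (y^t* *m x) = (mxvec x *m (mxvec y)^t*) 0 0.
Proof.
rewrite mxE (reindex _ (curry_mxvec_bij _ _)) /=.
(* Both sides are sums over the pairs of indices of x, in row-major order. *)
pose f i j := mxvec x 0 (mxvec_index i j) * (mxvec y)^t* (mxvec_index i j) 0.
transitivity (\sum_(p : 'I_m * 'I_m) f p.1 p.2); last by apply: eq_bigr => [[i j] _].
rewrite -(pair_bigA _ f) exchange_big /=; apply: eq_bigr => i _.
by rewrite mxE; apply: eq_bigr => j _ /=; rewrite /f !mxE !mxvecE mulrC.
Qed.

Section Basis.
Variable w : mrep G.
Local Notation m := (rdim w).

Definition relation (a : 'M[F]_m) := mcoef w a = 0.
(** The orthogonal complement of the relations; [mcoef w] is injective on it. *)
Definition orth_relation (y : 'M[F]_m) := forall x, relation x -> \tr (y^t* *m x) = 0.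

(** The family b is a basis of the coefficient space of w, obtained from an
    orthonormal basis of the orthogonal complement of the relations. *)
Lemma mcoef_basis :
  (exists r (b : 'I_r -> G) (D : 'I_r -> 'M[F]_m),
    (forall c : 'I_r -> F, \sum_s c s *: b s = 0 -> forall s, c s = 0) /\
    (forall k l, w k l = \sum_s D s k l *: b s)) /\
  (forall a, exists2 y, orth_relation y & mcoef w y = mcoef w a).
Proof.
have [||P [PP Ps] KP] := @subspace_proj F (m * m) (fun x => relation (vec_mx x)).
- by rewrite /relation linear0 mcoef0.
- by move=> a x y Kx Ky; rewrite /relation linearP mcoefL Kx Ky scaler0 addr0.
have kill x : mcoef w (vec_mx (x *m P)) = 0 by apply/KP; rewrite -mulmxA PP.
have pP' : is_proj (1%:M - P).
  split; last by rewrite trmxCB trmxC1 Ps.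
  by rewrite mulmxBl mul1mx mulmxBr mulmx1 PP subrr subr0.
split; last first.
  move=> a; exists (vec_mx (mxvec a *m (1%:M - P))).
    move=> x; rewrite /relation -[x]mxvecK => /KP xP; rewrite trace_mxvec mxvecK vec_mxK.
    have [_ es] := pP'; rewrite trmxCM es -xP mulmxA -(mulmxA _ P) mulmxBr PP mulmx1 subrr.
    by rewrite mulmx0 mul0mx mxE.
  by rewrite mulmxBr mulmx1 linearB /= mxvecK mcoefD -scaleN1r mcoefZ kill scaler0 addr0.
have [] := proj_onb pP'; move: (schmidt _); move: (\rank _) => r Q QQ1 QQ2.
exists r, (fun s => mcoef w (vec_mx (row s Q))), (fun s => \matrix_(k, l) (Q^t*) (mxvec_index k l) s).
split=> [c H s|k l].
  pose cr := \row_s c s; have K : relation (vec_mx (cr *m Q)).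
    rewrite /relation mulmx_sum_row linear_sum mcoef_sum -[RHS]H; apply: eq_bigr => t _.
    by rewrite linearZ mcoefZ mxE.
  move/KP: K => K; have: cr *m Q *m (Q^t* *m Q) = 0.
    by rewrite QQ2 mulmxBr mulmx1 K subrr.
  move/(congr1 (fun X => X *m Q^t*)); rewrite mul0mx -!mulmxA QQ1 mulmx1 QQ1 mulmx1.
  by move/rowP/(_ s); rewrite !mxE.
rewrite -mcoef_delta -[delta_mx k l]mxvecK mxvec_delta.
set x := delta_mx 0 _.
have -> : x = x *m P + x *m Q^t* *m Q.
  by rewrite -mulmxA QQ2 mulmxBr mulmx1 addrC subrK.
rewrite linearD mcoefD kill add0r mulmx_sum_row linear_sum mcoef_sum.
by apply: eq_bigr => s _; rewrite linearZ mcoefZ -rowE !mxE.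
Qed.

Lemma orth_relationL c y y' : orth_relation y -> orth_relation y' -> orth_relation (c *: y + y').
Proof.
move=> H H' x Kx; rewrite trmxCD trmxCZ mulmxDl -scalemxAl linearD linearZ /=.
by rewrite H // H' // mulr0 addr0.
Qed.

Lemma relation_orth_eq0 y : relation y -> orth_relation y -> y = 0.
Proof. by move=> Ky /(_ y Ky)/trace_gram_eq0. Qed.

Hypothesis cw : comatrix w.
Hypothesis kw : forall i j, star (coinv G (w i j)) = w j i.

(** The antilinear map sending x to star (coinv x) transposes w. *)
Lemma relation_adj x : relation x -> relation (x^t*).
Proof.
move=> Kx; have := congr1 (fun z => star (coinv G z)) Kx.
rewrite linear0 star0 /mcoef linear_sum star_sum => H.
rewrite /relation /mcoef exchange_big -[RHS]H; apply: eq_bigr => i _.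
rewrite linear_sum star_sum; apply: eq_bigr => j _.
by rewrite linearZ /= starZ kw !mxE.
Qed.

Section Invariance.
Variables (r : nat) (b : 'I_r -> G) (D : 'I_r -> 'M[F]_m).
Hypothesis bfree : forall c : 'I_r -> F, \sum_s c s *: b s = 0 -> forall s, c s = 0.
Hypothesis wE : forall k l, w k l = \sum_s D s k l *: b s.

Lemma mcoef_b a : mcoef w a = \sum_s (\sum_k \sum_l a k l * D s k l) *: b s.
Proof.
under [RHS]eq_bigr => s _ do rewrite scaler_suml.
rewrite exchange_big /mcoef; apply: eq_bigr => k _ /=.
under [RHS]eq_bigr => s _ do rewrite scaler_suml.
rewrite exchange_big; apply: eq_bigr => l _ /=.
by rewrite wE scaler_sumr; apply: eq_bigr => s _; rewrite scalerA.
Qed.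

(** Slicing the comultiplication of a coefficient along the basis b on the
    left; the slices are again coefficients of w. *)
Lemma comult_coef_l x : comult G (mcoef w x) = \sum_s ten (b s) (mcoef w ((D s)^T *m x)).
Proof.
rewrite /mcoef linear_sum /=.
transitivity (\sum_(q : 'I_m * 'I_m) ten (w q.1 q.2) (\sum_l x q.1 l *: w q.2 l)).
  rewrite -(pair_bigA _ (fun k q => ten (w k q) (\sum_l x k l *: w q l))) /=.
  apply: eq_bigr => k _; rewrite linear_sum /=.
  under [RHS]eq_bigr => q _ do rewrite /ten linear_sum mulr_sumr.
  rewrite exchange_big; apply: eq_bigr => l _ /=; rewrite linearZ /= cw scaler_sumr.
  by apply: eq_bigr => q _; rewrite linearZ /= /ten scalerAr.
transitivity (\sum_(q : 'I_m * 'I_m) ten (\sum_s D s q.1 q.2 *: b s) (\sum_l x q.1 l *: w q.2 l)).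
  by apply: eq_bigr => q _; rewrite -wE.
rewrite ten_suml; apply: eq_bigr => s _; congr (ten _ _).
rewrite -(pair_bigA _ (fun k q => D s k q *: \sum_l x k l *: w q l)) exchange_big /=.
apply: eq_bigr => q _; under eq_bigr => k _ do rewrite scaler_sumr.
rewrite exchange_big; apply: eq_bigr => l _ /=; rewrite mxE scaler_suml.
by apply: eq_bigr => k _; rewrite scalerA mxE.
Qed.

Lemma comult_coef_r x : comult G (mcoef w x) = \sum_s ten (mcoef w (x *m (D s)^T)) (b s).
Proof.
rewrite /mcoef linear_sum /=.
transitivity (\sum_(q : 'I_m * 'I_m) ten (\sum_k x k q.2 *: w k q.1) (w q.1 q.2)).
  rewrite -(pair_bigA _ (fun q l => ten (\sum_k x k l *: w k q) (w q l))) /=.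
  under eq_bigr => k _ do rewrite linear_sum.
  rewrite exchange_big [RHS]exchange_big /=; apply: eq_bigr => l _.
  under [RHS]eq_bigr => q _ do rewrite /ten linear_sum mulr_suml.
  rewrite [RHS]exchange_big; apply: eq_bigr => k _ /=; rewrite linearZ /= cw scaler_sumr.
  by apply: eq_bigr => q _; rewrite linearZ /= /ten scalerAl.
transitivity (\sum_(q : 'I_m * 'I_m) ten (\sum_k x k q.2 *: w k q.1) (\sum_s D s q.1 q.2 *: b s)).
  by apply: eq_bigr => q _; rewrite -wE.
rewrite ten_sumr; apply: eq_bigr => s _; congr (ten _ _).
rewrite -(pair_bigA _ (fun q l => D s q l *: \sum_k x k l *: w k q)) exchange_big /=.
under eq_bigr => l _ do under eq_bigr => q _ do rewrite scaler_sumr.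
under [RHS]eq_bigr => k _ do under eq_bigr => q _ do rewrite mxE scaler_suml.
rewrite [RHS]exchange_big /=; under [RHS]eq_bigr => q _ do rewrite exchange_big /=.
rewrite [RHS]exchange_big /=; apply: eq_bigr => l _; apply: eq_bigr => q _; apply: eq_bigr => k _.
by rewrite scalerA mxE mulrC.
Qed.

(** Since the comultiplication of zero is zero, all slices of a relation along
    a basis are relations. The slices are read off against a basis in the left factor,
    whence the second expansion along b. *)
Lemma relation_right x s : relation x -> relation (x *m (D s)^T).
Proof.
move=> Kx; have H := comult_coef_r x.
pose c t s := \sum_k \sum_l (x *m (D s)^T) k l * D t k l.
have H2 : \sum_t ten (b t) (\sum_s c t s *: b s) = 0.
  transitivity (comult G (mcoef w x)); last by rewrite Kx linear0.
  by rewrite H -ten_suml; apply: eq_bigr => u _; rewrite [in RHS]mcoef_b.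
have H3 t : \sum_s c t s *: b s = 0.
  exact: (tindep (t := square_of G) bfree H2 t).
by rewrite /relation mcoef_b big1 // => t _; apply: etrans (congr1 (fun z => z *: b t) (bfree (H3 t) s)) (scale0r _).
Qed.

(** The adjoint of left multiplication by (D s)^T preserves the relations,
    being right multiplication by (D s)^T conjugated by [relation_adj]. *)
Lemma orth_relation_left y s : orth_relation y -> orth_relation ((D s)^T *m y).
Proof.
move=> Hy x Kx; rewrite trmxCM -mulmxA; apply: Hy.
have := relation_adj (relation_right s (relation_adj Kx)).
by rewrite trmxCM trmxCK.
Qed.
End Invariance.

(** Fix j0 and lift each v i j0 to the element c i of the orthogonal complement
    of the relations. This complement is stable under the slices of the
    comultiplication, so that the lifts transform under w as the v i j0 do under
    v. Columns of the c i, assembled into matrices C l, are the intertwiners. *)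
Lemma mcoef_intertwiner v i0 j0 : comatrix v ->
  (forall i j, exists a : 'M[F]_m, v i j = mcoef w a) -> v i0 j0 != 0 ->
  exists2 C : 'M[F]_(rdim v, m), C != 0 & @Hom F N G w v C.
Proof.
move=> cv vw v0; have [[r [b [D [bfree wE]]]] perp] := mcoef_basis.
have [c Hc Ec] : exists2 c : 'I_(rdim v) -> 'M[F]_m, (forall i, orth_relation (c i)) & forall i, mcoef w (c i) = v i j0.
  apply: (fin_all_exists2 (P := fun i y => orth_relation y) (Q := fun i y => mcoef w y = v i j0)) => i.
  by have [a ->] := vw i j0; have [y Hy Ey] := perp a; exists y.
have [d Ed] : exists d : 'I_r -> 'M[F]_(rdim v), forall i j, v i j = \sum_s d s i j *: b s.
  have [a Ha] := fin_all_exists (fun ij : 'I_(rdim v) * 'I_(rdim v) => vw ij.1 ij.2).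
  exists (fun s => \matrix_(i, j) \sum_k \sum_l a (i, j) k l * D s k l) => i j.
  by rewrite (Ha (i, j)) (mcoef_b wE); apply: eq_bigr => s _; rewrite mxE.
have key s i : \sum_t d s i t *: c t = (D s)^T *m c i.
  (* Two expansions of the comultiplication of v i j0 along the basis b. *)
  have E1 : comult G (v i j0) = \sum_s ten (b s) (\sum_t d s i t *: v t j0).
    rewrite cv; under eq_bigr => t _ do rewrite [v i t]Ed.
    by rewrite ten_suml.
  have E2 : comult G (v i j0) = \sum_s ten (b s) (mcoef w ((D s)^T *m c i)).
    by rewrite -Ec (comult_coef_l wE).
  pose z u := \sum_t d u i t *: c t + (-1) *: ((D u)^T *m c i).
  have z0 : mcoef w (z s) = 0.
    apply: (tindep (t := square_of G) bfree _ s (x := b) (y := fun u => mcoef w (z u))).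
    transitivity (\sum_s ten (b s) (\sum_t d s i t *: v t j0) - \sum_s ten (b s) (mcoef w ((D s)^T *m c i))).
      rewrite -sumrB; apply: eq_bigr => u _; rewrite -mulrBr -linearB /=; congr (_ * tright _ _).
      rewrite /z mcoefD mcoefZ scaleN1r mcoef_sum; congr (_ - _).
      by apply: eq_bigr => t _; rewrite mcoefZ Ec.
    by rewrite -E1 -E2 subrr.
  have corz : orth_relation (z s).
    rewrite /z addrC; apply: orth_relationL; first exact: (orth_relation_left bfree wE).
    apply: (big_ind orth_relation) => [x _|x y Hx Hy|t _].
    - by rewrite trmxC0 mul0mx mxtrace0.
    - by rewrite -[x]scale1r; apply: orth_relationL.
    - by rewrite -[_ *: _]addr0; apply: orth_relationL => // x _; rewrite trmxC0 mul0mx mxtrace0.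
  by have /eqP := relation_orth_eq0 z0 corz; rewrite /z scaleN1r subr_eq0 => /eqP.
pose C l : 'M[F]_(rdim v, m) := \matrix_(i, k) c i k l.
have homC l : @Hom F N G w v (C l).
  apply/matrixP => i k; rewrite !mxE.
  transitivity (\sum_s (\sum_q c i q l * D s q k) *: b s).
    under [RHS]eq_bigr => s _ do rewrite scaler_suml.
    rewrite exchange_big; apply: eq_bigr => q _ /=.
    rewrite !mxE /= mulr_algl wE scaler_sumr; apply: eq_bigr => s _.
    by rewrite scalerA.
  transitivity (\sum_s (\sum_t d s i t * c t k l) *: b s).
    apply: eq_bigr => s _; congr (_ *: _).
    have /matrixP/(_ k l) := key s i; rewrite summxE [RHS]mxE => H.
    transitivity (\sum_t (d s i t *: c t) k l); last by apply: eq_bigr => t _; rewrite mxE.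
    by rewrite H; apply: eq_bigr => q _; rewrite mxE mulrC.
  under eq_bigr => s _ do rewrite scaler_suml.
  rewrite exchange_big; apply: eq_bigr => t _ /=.
  rewrite !mxE /= mulr_algr Ed scaler_sumr; apply: eq_bigr => s _.
  by rewrite scalerA mulrC.
have [[k l] /= ckl] : exists kl : 'I_m * 'I_m, c i0 kl.1 kl.2 != 0.
  apply/existsP; apply: contraNT v0 => /existsPn H; rewrite -Ec (_ : c i0 = 0) ?mcoef0 //.
  by apply/matrixP => k l; rewrite mxE; apply/eqP; have := H (k, l); rewrite negbK.
exists (C l) => //; apply: contraNneq ckl => /matrixP/(_ i0 k).
by rewrite !mxE => ->.
Qed.

End Basis.
End Coefficients.
Arguments mcoef {F N G} w a.

(** * Irreducible representations *)

Section Functions.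
Variables (N k : nat).

Definition midx_rcons (hl : midx N k * 'I_N) : midx N k.+1 :=
  [ffun a => if unlift ord_max a is Some a' then hl.1 a' else hl.2].

Definition midx_belast (g : midx N k.+1) : midx N k := [ffun a => g (widen_ord (leqnSn k) a)].

Lemma widen_lift (a : 'I_k) : widen_ord (leqnSn k) a = lift ord_max a.
Proof. by apply: val_inj; rewrite /= /bump leqNgt ltn_ord. Qed.

Lemma midx_rcons_widen hl a : midx_rcons hl (widen_ord (leqnSn k) a) = hl.1 a.
Proof. by rewrite ffunE widen_lift liftK. Qed.

Lemma midx_rcons_max hl : midx_rcons hl ord_max = hl.2.
Proof. by rewrite ffunE unlift_none. Qed.

Lemma midx_rconsK g : midx_rcons (midx_belast g, g ord_max) = g.
Proof.
apply/ffunP => a; rewrite ffunE; case: unliftP => [b ->|-> //].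
by rewrite ffunE widen_lift.
Qed.

Lemma sum_midx_rcons (V : nmodType) (f : midx N k.+1 -> V) :
  \sum_g f g = \sum_h \sum_l f (midx_rcons (h, l)).
Proof.
rewrite (reindex midx_rcons) /=; last first.
  exists (fun g => (midx_belast g, g ord_max)) => [[h l] _|g _]; last exact: midx_rconsK.
  congr (_, _); last exact: midx_rcons_max.
  by apply/ffunP => a; rewrite ffunE midx_rcons_widen.
by rewrite (pair_bigA _ (fun h l => f (midx_rcons (h, l)))) /=; apply: eq_bigr => [[]].
Qed.

Lemma midx_eq (g g' : midx N k.+1) :
  (g == g') = (midx_belast g == midx_belast g') && (g ord_max == g' ord_max).
Proof.
apply/eqP/andP => [-> //|[/eqP e /eqP e']].
by rewrite -[g]midx_rconsK -[g']midx_rconsK e e'.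
Qed.

End Functions.

Section TensorPowers.
Variables (F : numClosedFieldType) (n : nat).
Local Notation N := n.+1.
Variable G : cmqg F N.
Local Notation u := (fund G).
Implicit Types v w : mrep G.

Lemma prod_ten (I : Type) (r : seq I) (x y : I -> G) :
  \prod_(a <- r) ten (x a) (y a) = ten (\prod_(a <- r) x a) (\prod_(a <- r) y a).
Proof.
elim: r => [|a r IH]; first by rewrite !big_nil /ten !rmorph1 mulr1.
rewrite !big_cons IH /ten !rmorphM /= !mulrA; congr (_ * _); rewrite -!mulrA; congr (_ * _).
by rewrite tcomm.
Qed.

Lemma tpow_comatrix k : comatrix (tpow G k).
Proof.
move=> i j; rewrite /tpow /= mxE rmorph_prod.
rewrite (eq_bigr _ (fun a _ => comult_fund _ _ _)) bigA_distr_bigA /=.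
under [RHS]eq_bigr => r _ do rewrite !mxE.
pose f h := ten (\prod_(a < k) u ((enum_val i : midx N k) a) ((h : midx N k) a))
                (\prod_(a < k) u (h a) ((enum_val j : midx N k) a)).
transitivity (\sum_h f h); last by rewrite -(sum_enum_val f).
by apply: eq_bigr => h _; rewrite /f -prod_ten.
Qed.

(** The antipode reverses products and transposes u, and the unit is an entry
    of u^T u and of u u^T. *)
Lemma coinv1 : coinv G 1 = 1.
Proof.
have [uu uu'] := fund_orth G.
have /matrixP/(_ ord0 ord0) := uu; have /matrixP/(_ ord0 ord0) := uu'.
rewrite !mxE eqxx mulr1n => E1 E2; rewrite -[in LHS]E2 -[in RHS]E1 linear_sum.
by apply: eq_bigr => j _; rewrite !mxE /= coinvM !coinv_fund.
Qed.

Lemma tpow_coinv k i j : star (coinv G (tpow G k i j)) = tpow G k j i.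
Proof.
rewrite /tpow /= !mxE.
rewrite (big_morph (fun x => star (coinv G x)) (id1 := 1) (op1 := *%R)).
- by apply: eq_bigr => a _; rewrite coinv_fund fund_sa.
- by move=> x y; rewrite coinvM starM.
- by rewrite coinv1 star1.
Qed.

(** The product telescopes from its middle, which holds the last tensor
    factor. *)
Lemma tpow_row_orth k (i j : midx N k) :
  \sum_(h : midx N k) (\prod_(a < k) u (i a) (h a)) * star (\prod_(a < k) u (j a) (h a)) =
    (i == j)%:R.
Proof.
elim: k i j => [|k IH] i j.
  have ij : i = j by apply/ffunP => [[]].
  rewrite ij eqxx (bigD1 j) //= !big_ord0 star1 mulr1 big1 ?addr0 // => h /eqP[].
  by apply/ffunP => [[]].
rewrite sum_midx_rcons midx_eq.
have [uu _] := fund_orth G; have /matrixP/(_ (i ord_max) (j ord_max)) := uu.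
rewrite !mxE => E; pose P (g : midx N k.+1) (h : midx N k) : G := \prod_(a < k) u (midx_belast g a) (h a).
transitivity (\sum_h P i h * (i ord_max == j ord_max)%:R * star (P j h)).
  apply: eq_bigr => h _; rewrite -E mulr_sumr mulr_suml; apply: eq_bigr => l _.
  have Q (g : midx N k.+1) : \prod_(a < k.+1) u (g a) (midx_rcons (h, l) a) = P g h * u (g ord_max) l.
    rewrite big_ord_recr /= midx_rcons_max; congr (_ * _); apply: eq_bigr => a _.
    by rewrite midx_rcons_widen ffunE.
  by rewrite !Q starM fund_sa !mxE !mulrA.
case: (i ord_max == j ord_max); last first.
  by rewrite andbF big1 // => h _; rewrite mulr0 mul0r.
by rewrite andbT -IH; apply: eq_bigr => h _; rewrite mulr1.
Qed.

Lemma tpow_unitary k : rmx (tpow G k) *m mxstar (tpow G k) = 1%:M.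
Proof.
apply/matrixP => i j; rewrite !mxE.
pose f (h : midx N k) := (\prod_(a < k) u ((enum_val i : midx N k) a) (h a)) *
  star (\prod_(a < k) u ((enum_val j : midx N k) a) (h a)).
transitivity (\sum_h f h); first by rewrite -[RHS]sum_enum_val; apply: eq_bigr => h _; rewrite !mxE.
by rewrite tpow_row_orth (inj_eq enum_val_inj).
Qed.

Definition word (s : seq ('I_N * 'I_N)) : G := \prod_(ab <- s) u ab.1 ab.2.

Lemma word_cat s t : word (s ++ t) = word s * word t.
Proof. by rewrite /word big_cat. Qed.

Lemma star_word s : star (word s) = word (rev s).
Proof.
elim: s => [|ab s IH]; first by rewrite /word /= !big_nil star1.
rewrite rev_cons -cats1 word_cat -IH /word big_cons starM fund_sa.
by rewrite big_seq1.
Qed.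

(** The entries of u are self-adjoint, so that the span of the words is
    stable under the involution. *)
Lemma words_span (x : G) : exists s : seq (F * seq ('I_N * 'I_N)), x = \sum_(t <- s) t.1 *: word t.2.
Proof.
apply: (fund_gen (c := G) (S := fun x => exists s : seq (F * seq ('I_N * 'I_N)), x = \sum_(t <- s) t.1 *: word t.2)).
- by exists [:: (1, [::])]; rewrite big_seq1 scale1r /word big_nil.
- by move=> i j; exists [:: (1, [:: (i, j)])]; rewrite big_seq1 scale1r /word big_seq1.
- by move=> y z [s ->] [t ->]; exists (s ++ t); rewrite big_cat.
- move=> y z [s ->] [t ->]; exists [seq (a.1 * b.1, a.2 ++ b.2) | a <- s, b <- t].
  rewrite big_allpairs_dep mulr_suml; apply: eq_bigr => a _.
  rewrite mulr_sumr; apply: eq_bigr => b _ /=.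
  by rewrite word_cat -scalerAl -scalerAr scalerA.
- move=> a y [s ->]; exists [seq (a * t.1, t.2) | t <- s].
  by rewrite big_map scaler_sumr; apply: eq_bigr => t _; rewrite scalerA.
- move=> y [s ->]; exists [seq (t.1^*, rev t.2) | t <- s].
  by rewrite big_map star_sum; apply: eq_bigr => t _; rewrite starZ star_word.
Qed.

Lemma word_tpow s : exists a, word s = mcoef (tpow G (size s)) a.
Proof.
pose i : midx N (size s) := [ffun a => (tnth (in_tuple s) a).1].
pose j : midx N (size s) := [ffun a => (tnth (in_tuple s) a).2].
exists (delta_mx (enum_rank i) (enum_rank j)); rewrite mcoef_delta /tpow /= mxE !enum_rankK.
by rewrite /word big_tnth; apply: eq_bigr => a _; rewrite !ffunE.
Qed.

Definition tpows (L : seq nat) : mrep G := foldr (fun l w => dsum (tpow G l) w) (rep0 G) L.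

Lemma dsum_comatrix v w : comatrix v -> comatrix w -> comatrix (dsum v w).
Proof.
move=> cv cw i j; rewrite /dsum /= big_split_ord /=.
(* Only the diagonal blocks contribute to the sum over the middle index. *)
have t0 (x : G) : ten 0 x = 0 /\ ten x 0 = 0 by rewrite /ten !linear0 mul0r mulr0.
rewrite -(splitK i) -(splitK j); case: (split i) (split j) => i' [] j' /=;
  rewrite ?(block_mxEul, block_mxEur, block_mxEdl, block_mxEdr).
- rewrite cv [X in _ + X]big1 ?addr0 => [|r _]; last by rewrite block_mxEur mxE (t0 _).1.
  by apply: eq_bigr => r _; rewrite !block_mxEul.
- rewrite mxE linear0 !big1 ?addr0 // => r _; rewrite ?block_mxEul ?block_mxEur mxE ?(t0 _).1 ?(t0 _).2 //.
- rewrite mxE linear0 !big1 ?addr0 // => r _; rewrite ?block_mxEdl ?block_mxEdr ?block_mxEul mxE ?(t0 _).1 ?(t0 _).2 //.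
- rewrite cw [X in X + _]big1 ?add0r => [|r _]; last by rewrite block_mxEdl mxE (t0 _).1.
  by apply: eq_bigr => r _; rewrite !block_mxEdr.
Qed.

Lemma dsum_coinv v w : (forall i j, star (coinv G (v i j)) = v j i) ->
  (forall i j, star (coinv G (w i j)) = w j i) ->
  forall i j, star (coinv G (dsum v w i j)) = dsum v w j i.
Proof.
move=> cv cw i j; rewrite /dsum /= -(splitK i) -(splitK j); case: (split i) (split j) => i' [] j' /=;
  rewrite ?(block_mxEul, block_mxEur, block_mxEdl, block_mxEdr) ?mxE ?linear0 ?star0 //.
Qed.

Lemma tpows_comatrix L : comatrix (tpows L).
Proof.
by elim: L => [|l L IH] /=; [case | apply: dsum_comatrix; first exact: tpow_comatrix].
Qed.

Lemma tpows_coinv L i j : star (coinv G (tpows L i j)) = tpows L j i.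
Proof.
elim: L i j => [|l L IH] /=; first by case.
exact: dsum_coinv (@tpow_coinv l) IH.
Qed.

Lemma mcoef_dsuml v w a : mcoef (dsum v w) (block_mx a 0 0 0) = mcoef v a.
Proof.
rewrite /mcoef /= big_split_ord /= [X in _ + X]big1 ?addr0 => [|i _]; last first.
  by rewrite big_split_ord /= !big1 ?addr0 // => j _; rewrite ?block_mxEdl ?block_mxEdr mxE scale0r.
apply: eq_bigr => i _; rewrite big_split_ord /= [X in _ + X]big1 ?addr0 => [|j _]; last first.
  by rewrite block_mxEur mxE scale0r.
by apply: eq_bigr => j _; rewrite !block_mxEul.
Qed.

Lemma mcoef_dsumr v w a : mcoef (dsum v w) (block_mx 0 0 0 a) = mcoef w a.
Proof.
rewrite /mcoef /= big_split_ord /= [X in X + _]big1 ?add0r => [|i _]; last first.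
  by rewrite big_split_ord /= !big1 ?addr0 // => j _; rewrite ?block_mxEul ?block_mxEur mxE scale0r.
apply: eq_bigr => i _; rewrite big_split_ord /= [X in X + _]big1 ?add0r => [|j _]; last first.
  by rewrite block_mxEdl mxE scale0r.
by apply: eq_bigr => j _; rewrite !block_mxEdr.
Qed.

Lemma mcoef_tpows L l a : l \in L -> exists a', mcoef (tpow G l) a = mcoef (tpows L) a'.
Proof.
elim: L a => [//|l' L IH] a; rewrite inE => /orP[/eqP e|/(IH a)[a' ->]].
  by move: a; rewrite e => a; exists (block_mx a 0 0 0); rewrite mcoef_dsuml.
by exists (block_mx 0 0 0 a'); rewrite mcoef_dsumr.
Qed.

(** Words occurring in the finitely many x i are coefficients of the
    corresponding tensor powers. *)
Lemma mcoef_family (I : finType) (x : I -> G) :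
  exists L, forall i, exists a, x i = mcoef (tpows L) a.
Proof.
have [s Hs] := fin_all_exists (fun i => words_span (x i)).
exists (flatten [seq [seq size t.2 | t <- s i] | i <- enum I]) => i.
set L := flatten _; have : {subset [seq size t.2 | t <- s i] <= L}.
  by move=> l ls; apply/flattenP; exists [seq size t.2 | t <- s i] => //; apply: map_f; rewrite mem_enum.
rewrite Hs; elim: (s i) => [|t si IH] sL.
  by exists 0; rewrite big_nil mcoef0.
have [|a Ea] := IH; first by move=> l ls; apply: sL; rewrite inE ls orbT.
have [b Eb] := word_tpow t.2.
have [|c Ec] := @mcoef_tpows L (size t.2) b; first by apply: sL; rewrite inE eqxx.
by exists (t.1 *: c + a); rewrite big_cons mcoefL -Ec -Eb Ea.
Qed.

Lemma Hom_tpows v L (C : 'M[F]_(rdim v, rdim (tpows L))) : C != 0 ->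
  @Hom F N G (tpows L) v C ->
  exists k, exists2 D : 'M[F]_(rdim v, rdim (tpow G k)), D != 0 & @Hom F N G (tpow G k) v D.
Proof.
elim: L C => [|l L IH] /= C; first by rewrite [C]thinmx0 eqxx.
rewrite -[C]hsubmxK; move: (lsubmx C) (rsubmx C) => C1 C2 C0.
rewrite /Defs.Hom /scal_mx map_row_mx /= mul_row_block !mulmx0 addr0 add0r mul_mx_row.
case/eq_row_mx => H1 H2; have [E1|C10] := eqVneq C1 0; last by exists l, C1.
by apply: (IH C2) H2; apply: contraNneq C0 => ->; rewrite E1 row_mx0.
Qed.

End TensorPowers.

Section Schur.
Variables (F : numClosedFieldType) (N : nat) (G : cmqg F N).
Implicit Types v w : mrep G.

Definition starmx m n (X : 'M[G]_(m, n)) : 'M[G]_(n, m) := \matrix_(i, j) star (X j i).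

Lemma starmxM m n p (X : 'M[G]_(m, n)) (Y : 'M[G]_(n, p)) :
  starmx (X *m Y) = starmx Y *m starmx X.
Proof.
apply/matrixP => i j; rewrite !mxE star_sum; apply: eq_bigr => r _.
by rewrite starM !mxE.
Qed.

Lemma starmx_scal m n (C : 'M[F]_(m, n)) : starmx (scal_mx G C) = scal_mx G (C^t*).
Proof. by apply/matrixP => i j; rewrite !mxE /= starZ star1. Qed.

Lemma Hom_adj v w C : rmx w *m mxstar w = 1%:M -> mxstar v *m rmx v = 1%:M ->
  @Hom F N G w v C -> @Hom F N G v w (C^t*).
Proof.
move=> ww vv /(congr1 (fun X => starmx X)); rewrite !starmxM starmx_scal => H.
have {}H : mxstar w *m scal_mx G (C^t*) = scal_mx G (C^t*) *m mxstar v by [].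
rewrite /Defs.Hom -[LHS]mul1mx -ww -mulmxA [mxstar w *m _]mulmxA H -!mulmxA.
by rewrite vv mulmx1.
Qed.

Lemma urep_alg v : is_urep v -> matalg (@Hom F N G v v).
Proof.
case=> _ vv vv'; split=> [|a x y|x y Hx Hy|x].
- exact: Hom1.
- exact: HomL.
- exact: HomM Hy Hx.
- exact: Hom_adj.
Qed.

Lemma irreducible_scalar v x : is_urep v -> irreducible v -> @Hom F N G v v x ->
  exists c, x = c *: 1%:M.
Proof.
move=> uv [_ irr] Hx; have algv := urep_alg uv.
have p1 : is_proj (1%:M : 'M[F]_(rdim v)) by split; rewrite ?mulmx1 ?trmxC1.
have [|c] := min_corner algv p1 (matalg1 algv) _ Hx.
  by move=> f pf Af _; apply: irr.
by rewrite mul1mx mulmx1; exists c.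
Qed.

(** Both C^t* C and C C^t* are scalar, on the range of E and on v; the two
    scalars agree and are positive, so that a multiple of C is unitary. *)
Lemma Schur_subrep v w (E : 'M[F]_(rdim w)) (C : 'M[F]_(rdim v, rdim w)) :
  is_urep v -> irreducible v -> rmx w *m mxstar w = 1%:M ->
  is_proj E ->
  (forall x, @Hom F N G w w x -> exists c, E *m x *m E = c *: E) ->
  C != 0 -> C *m E = C -> @Hom F N G w v C -> uequiv v (subrep E).
Proof.
move=> uv irr ww pE corner C0 CE HC; have [_ _ vv] := uv; have [EE Es] := pE.
have HCs := Hom_adj ww vv HC.
have [c Hc] := corner _ (HomM HC HCs).
have ECs : E *m C^t* = C^t* by rewrite -{1}Es -trmxCM CE.
have CC : C^t* *m C = c *: E by rewrite -Hc mulmxA ECs -mulmxA CE.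
have c0 : 0 < c := gram_scale_gt0 pE CC C0.
have [d Cd] := irreducible_scalar uv irr (HomM HCs HC).
have dc : d = c.
  have : (d - c) *: C = 0.
    have : C *m C^t* *m C = C *m (C^t* *m C) by rewrite mulmxA.
    rewrite Cd CC -scalemxAl mul1mx -scalemxAr CE => H.
    by rewrite scalerBl H subrr.
  by move/eqP; rewrite scaler_eq0 (negPf C0) orbF subr_eq0 => /eqP.
rewrite dc in Cd.
have [b bc] : exists b : F, b * b^* * c = 1.
  exists (sqrtC c)^-1; have -> : ((sqrtC c)^-1)^* = (sqrtC c)^-1 :> F.
    by apply: CrealP; rewrite rpredV realE sqrtC_ge0 ltW.
  by rewrite -invfM -expr2 sqrtCK mulVf // gt_eqF.
have := proj_onb pE; rewrite /subrep /uequiv /=; move: (schmidt _) => Q [QQ1 QQ2].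
have QE : Q *m E = Q by have : Q *m (Q^t* *m Q) = Q; [rewrite mulmxA QQ1 mul1mx | rewrite QQ2].
exists (b *: (Q *m C^t*)); split.
- rewrite /Defs.Hom /= scalZ -scalemxAl mul_in_alg_mx; congr (_ *: _).
  rewrite scalM -mulmxA HCs !mulmxA -(mulmxA _ (scal_mx G (Q^t*))) -scalM QQ2.
  by rewrite -(mulmxA _ (scal_mx G E)) -scalM ECs.
- rewrite trmxCZ trmxCM trmxCK -scalemxAl -scalemxAr scalerA mulmxA -(mulmxA C) QQ2 CE Cd.
  by rewrite scalerA [b^* * b]mulrC bc scale1r.
- rewrite trmxCZ trmxCM trmxCK -scalemxAl -scalemxAr scalerA mulmxA -(mulmxA Q) CC.
  by rewrite -scalemxAr -scalemxAl scalerA QE QQ1 bc scale1r.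
Qed.

End Schur.

Section Irreducibles.
Variables (F : numClosedFieldType) (n : nat).
Local Notation N := n.+1.
Variables (G : cmqg F N) (K : category).
Hypothesis hG : easy G K.

Lemma irreducible_tpow (v : mrep G) : is_urep v -> irreducible v ->
  exists k, exists2 D : 'M[F]_(rdim v, rdim (tpow G k)), D != 0 & @Hom F N G (tpow G k) v D.
Proof.
case=> cv _ vv [v0 _].
have [[i0 j0] /= vij] : exists ij : 'I_(rdim v) * 'I_(rdim v), v ij.1 ij.2 != 0.
  apply: contrapT => H; have z i j : v i j = 0.
    by apply/eqP; apply/negPn/negP => vij; apply: H; exists (i, j).
  have /matrixP/(_ (Ordinal v0) (Ordinal v0)) := vv.
  rewrite !mxE eqxx mulr1n big1 => [/esym/eqP|r _]; last by rewrite z mulr0.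
  by rewrite oner_eq0.
have [L HL] := mcoef_family (fun ij : 'I_(rdim v) * 'I_(rdim v) => v ij.1 ij.2).
have [C C0 HC] := mcoef_intertwiner (@tpows_comatrix _ _ G L) (@tpows_coinv _ _ G L) cv
  (fun i j => HL (i, j)) vij.
exact: Hom_tpows C0 HC.
Qed.

Variable e : forall k (p : part k k), Irr F K p -> gralg F K p.
Hypothesis he : forall k (p : part k k) (a : Irr F K p), p \in Proj K k -> minimal_proj a (@e k p a).

(** If D vanished on the ranges of all the X, it would vanish on all the
    ranges of the P_p, which span the tensor power. *)
Lemma irreducible_label (v : mrep G) : is_urep v -> irreducible v ->
  exists k (p : part k k) (a : Irr F K p),
    p \in Proj K k /\ uequiv v (u_p_alpha G (e a)).
Proof.
move=> uv irr; have [k [D D0 HD]] := irreducible_tpow uv irr.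
exists k; apply: contrapT => no; case/eqP: D0; apply: (Pp_total hG) => p pK.
rewrite (Pp_sum_Psi hG pK) mulmx_sumr big1 // => a _.
have mine := he a pK; have [X [Y [AX XE ->]]] := Psi_minimal_gen hG pK mine.
rewrite mulmx_sumr big1 // => i _; rewrite mulmxA.
suff -> : D *m X i = 0 by rewrite mul0mx.
apply/eqP/negPn/negP => DX0; apply: no; exists p, a; split=> //.
apply: (Schur_subrep uv irr (@tpow_unitary _ _ G k) (Psi_minimal_proj hG pK mine)
  (Psi_minimal_corner hG pK mine) DX0).
  by rewrite -mulmxA XE.
exact: HomM (AX i) HD.
Qed.

End Irreducibles.

Unset Implicit Arguments.
Local Close Scope sesquilinear_scope.
Local Close Scope ring_scope.

Theorem theorem4p24 (R : realType) (K : category) (N : nat) (hN : (0 < N)%N)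
    (G : cmqg R[i] N) (hG : easy G K)
    (e : forall k (p : part k k), Irr R[i] K p -> gralg R[i] K p)
    (he : forall k (p : part k k) (a : Irr R[i] K p),
        p \in Proj K k -> minimal_proj a (e k p a)) :
  (forall v : mrep G, is_urep v -> irreducible v ->
     exists k (p : part k k) (a : Irr R[i] K p),
       p \in Proj K k /\ uequiv v (u_p_alpha G (e k p a)))
  /\
  (forall k : nat, exists nu : forall p : part k k, Irr R[i] K p -> nat,
     (forall (p : part k k) (a : Irr R[i] K p),
        p \in Proj K k -> (nu p a <= irr_degree a)%N) /\
     uequiv (tpow G k)
       (\big[@dsum R[i] N G/rep0 G]_(p in Proj K k)
          \big[@dsum R[i] N G/rep0 G]_(a : Irr R[i] K p)
             dmult (nu p a) (u_p_alpha G (e k p a)))).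
Proof.
case: N hN G hG => // n _ G hG; split=> [v uv irr|k].
  exact: (irreducible_label hG he uv irr).
exact: (tpow_decomposition hG (he k)).
Qed.
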